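(* Let $\Omega$ be a star graph with center point $\mathrm P$ and outer paths $\Omega_1,\ldots,\Omega_N$ $(N\ge2)$, and let $\rho_i$ be the thickness of $\Omega_i$. Define $$R_i:=\frac{\sum_{k\ne i}\rho_k}{\rho_i}\qquad(i=1,\ldots,N).$$ Then the following criterion holds for each $i\in\{1,\ldots,N\}$: $$F(1)+(R_i^2-1)F(a)>0\ \Rightarrow\ \mathcal P(i,j)=1\ \text{ for all }j\ne i,$$ $$F(1)+(R_i^2-1)F(a)\le0\ \Rightarrow\ \mathcal P(i,j)=0\ \text{ for all }j\ne i.$$ Furthermore, in the former case, $\widehat v_i\equiv1$ on $\Omega$.
   Context: Star graph: $\Omega=\Omega_1\cup\cdots\cup\Omega_N$, where each outer path $\Omega_i$ is a half line with coordinate $x_i\in[0,\infty)$ and the endpoints $x_i=0$ of all $\Omega_i$ are identified with a single vertex $\mathrm P$. Each $\Omega_i$ has a constant thickness $\rho_i>0$. The Kirchhoff condition at $\mathrm P$ is $\sum_{i=1}^N\rho_i\,\partial_{x_i}u(\mathrm P)=0$. Nonlinearity: $f\in C^1$ and for some $0<a<1$: $f(0)=f(a)=f(1)=0$, $f<0$ on $(0,a)$, $f>0$ on $(a,1)$, $f'(0)<0$, $f'(a)>0$, $f'(1)<0$, $\int_0^1f(s)\,ds>0$. $F(s)=\int_0^sf(r)\,dr$. Solution of $\partial_tu=\Delta_\Omega u+f(u)$ on a time interval: a function $u(t,x)$ continuous in $(t,x)$ that satisfies $\partial_tu=\partial_{x_i}^2u+f(u)$ on each $\Omega_i$ for $x_i>0$,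 with $\partial_{x_i}u$ continuous up to $x_i=0$, and the Kirchhoff condition at $\mathrm P$. Traveling wave: $(\phi,c)$, $c>0$, is the unique pair with $\phi''+c\phi'+f(\phi)=0$ and $0<\phi<1$ on $\mathbb R$, $\phi(-\infty)=1$, $\phi(+\infty)=0$, $\phi(0)=a$. Front-like solution and limit profile: for each $i$ there is a unique entire solution $\widehat u_i$ (defined for all $t\in\mathbb R$) with $0<\widehat u_i<1$ and $\lim_{t\to-\infty}\big(\sup_{x_i\in\Omega_i}|\widehat u_i|_{\Omega_i}(t,x_i)-\phi(-x_i-ct)|+\sup_{\Omega\setminus\Omega_i}|\widehat u_i(t,\cdot)|\big)=0$; it is strictly increasing in $t$. The limit profile is $\widehat v_i(x)=\lim_{t\to\infty}\widehat u_i(t,x)$. Propagation index: for $i\ne j$, $\lim_{x_j\to\infty}\widehat v_i|_{\Omega_j}(x_j)$ exists and equals $1$ or $0$. If it is $1$, propagation occurs from $\Omega_i$ to $\Omega_j$ and $\mathcal P(i,j)=1$; if it is $0$, blocking occurs and $\mathcal P(i,j)=0$. *)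

(* Defs.v *)
From HB Require Import structures.
From mathcomp Require Import all_boot all_order all_algebra.
From mathcomp Require Import all_classical all_reals all_analysis.

Set Implicit Arguments.
Unset Strict Implicit.
Unset Printing Implicit Defensive.

Import Order.TTheory GRing.Theory Num.Theory.
Import numFieldNormedType.Exports.

Local Open Scope classical_set_scope.
Local Open Scope ring_scope.

Local Notation "f ^` ()" := (derive1 f) : ring_scope.

(* A function on the star graph with outer paths indexed by 'I_N is a family
   w : 'I_N -> R -> R, where w i x is the value at the point of coordinate
   x >= 0 of the i-th half line; all the w i 0 are the value at the centre P.
   Values at x < 0 have no meaning and are never used. *)

(* F(s) = \int_0^s f, used for s >= 0 only. *)
Definition primitive (R : realType) (f : R -> R) (s : R) : R :=
  \int[lebesgue_measure]_(r in `[0, s]) f r.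

Definition bistable (R : realType) (f : R -> R) (a : R) : Prop :=
  [/\ (forall s, derivable f s 1) /\ continuous f^`(),
      0 < a < 1,
      [/\ f 0 = 0, f a = 0 & f 1 = 0],
      (forall s, 0 < s < a -> f s < 0) /\ (forall s, a < s < 1 -> 0 < f s) &
      [/\ f^`() 0 < 0, 0 < f^`() a, f^`() 1 < 0 & 0 < primitive f 1]].

Definition traveling_wave (R : realType) (f : R -> R) (a : R)
    (phi : R -> R) (c : R) : Prop :=
  [/\ 0 < c,
      forall z, derivable phi z 1 /\ derivable phi^`() z 1,
      forall z, phi^`()^`() z + c * phi^`() z + f (phi z) = 0,
      forall z, 0 < phi z < 1 &
      [/\ phi z @[z --> -oo_R] --> (1 : R),
          phi z @[z --> +oo_R] --> (0 : R) &
          phi 0 = a]].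

(* u i t x is the value at time t; ux i t x is the derivative in x, one-sided
   at x = 0. *)
Definition entire_solution (R : realType) (N : nat) (rho : 'I_N -> R)
    (f : R -> R) (u : 'I_N -> R -> R -> R) : Prop :=
  (forall i, {within [set tx : R * R | 0 <= tx.2],
                continuous (fun tx : R * R => u i tx.1 tx.2)}) /\
  (forall i j t, u i t 0 = u j t 0) /\
  exists ux : 'I_N -> R -> R -> R,
    [/\ forall i t (x : R), 0 < x -> is_derive x 1 (u i t) (ux i t x),
        forall i t, h^-1 * (u i t h - u i t 0) @[h --> 0^'+] --> ux i t 0,
        forall i, {within [set tx : R * R | 0 <= tx.2],
                     continuous (fun tx : R * R => ux i tx.1 tx.2)},
        forall i t (x : R), 0 < x ->
          [/\ derivable (fun s => u i s x) t 1,
              derivable (ux i t) x 1 &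
              (fun s => u i s x)^`() t = (ux i t)^`() x + f (u i t x)] &
        forall t, \sum_(i < N) rho i * ux i t 0 = 0].

(* Given 0 < u < 1 and 0 < phi < 1, both suprema are over bounded sets; the
   second one is over the points of the graph that are not on the i-th path,
   which contains the centre. *)
Definition front_like_solution (R : realType) (N : nat) (rho : 'I_N -> R)
    (f phi : R -> R) (c : R) (i : 'I_N) (u : 'I_N -> R -> R -> R) : Prop :=
  [/\ entire_solution rho f u,
      forall j t (x : R), 0 <= x -> 0 < u j t x < 1 &
      sup [set `|u i t x - phi (- x - c * t)| | x in [set x : R | 0 <= x]] +
      sup [set `|u p.1 t p.2| |
             p in [set p : 'I_N * R | p.1 != i /\ 0 < p.2]]
        @[t --> -oo_R] --> (0 : R)].

(* The limit exists for a front-like solution, which is increasing in t and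
   bounded; monotonicity follows from the definition and is not assumed. *)
Definition limit_profile (R : realType) (N : nat) (u : 'I_N -> R -> R -> R) :
    'I_N -> R -> R :=
  fun j x => lim (u j t x @[t --> +oo_R]).

(* propagation_index v i j k means P(i,j) = k, where v is the limit profile of
   the front-like solution coming from the i-th path. *)
Definition propagation_index (R : realType) (N : nat) (v : 'I_N -> R -> R)
    (i j : 'I_N) (k : nat) : Prop :=
  i != j /\
  ((k = 1%N /\ v j x @[x --> +oo_R] --> (1 : R)) \/
   (k = 0%N /\ v j x @[x --> +oo_R] --> (0 : R))).

Definition thickness_ratio (R : realType) (N : nat) (rho : 'I_N -> R)
    (i : 'I_N) : R :=
  (\sum_(k < N | k != i) rho k) / rho i.

(* Main.v *)
Require Import Defs.
From HB Require Import structures.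
From mathcomp Require Import all_boot all_order all_algebra.
From mathcomp Require Import all_classical all_reals all_analysis.
From mathcomp Require Import ring lra.
Import Order.TTheory GRing.Theory Num.Theory.
Import numFieldNormedType.Exports.
Local Open Scope classical_set_scope.
Local Open Scope ring_scope.
Local Notation "f ^` ()" := (derive1 f) : ring_scope.
Set Implicit Arguments.
Unset Strict Implicit.
Unset Printing Implicit Defensive.

(** Let r be the ratio of the thicknesses of the other paths to that of the
    incoming path. The solutions of v'' + f(v) = 0 have the first integral
    v'^2/2 + F(v). A stationary state that rises to 1 along the incoming path
    and decays to 0 along the others, with value b at the centre, has slope
    sqrt(2(F(1) - F(b))) on the incoming path and - sqrt(- 2F(b)) on the
    others; its Kirchhoff sum has the sign of F(1) + (r^2 - 1)F(b). At b = a
    this is the quantity of the criterion, and when r >= 1 this is its least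
    value.

    Blocking. If the quantity is nonpositive, the state with b = a is a
    supersolution V ([steady_barrier_exists]) and it stays above the
    front-like solution u for all times ([blocking_upper_bound]). Close to time
    - oo, u is below V + e for every e > 0, while u can exceed V only where
    both are near 0 or both are near 1, the two regions where f decreases and
    where adding a constant to V preserves the comparison. This gives u <= V
    at all early times, and the Lipschitz bound on f propagates it
    ([ancient_comparison]).

    Propagation. If the quantity is positive, there is room to replace f by
    f - eta. Let M < 1 be the zero of f - eta near 1. On the incoming path a
    profile of v'' + f(v) = eta rises from below 0 to M; on the others one uses
    the profile of v'' + h(v) = 0 with h = min(f - eta, (f - eta)/r^2), whose
    slope at each level is at most 1/r times the slope of the first one
    (r is replaced by 1 when r < 1). The integral of h from any level up to M
    is positive exactly because of the criterion, so this profile reaches M as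
    well ([invading_profiles_exist]). Let the second profile move outward
    slowly and let the first one move so that the two agree at the centre: the
    result is a subsolution, the margin eta paying for the motion and the ratio
    of the slopes giving the sign of the Kirchhoff sum. It lies below u at some
    early time and converges to M locally uniformly ([invasion_lower_bound]).
    As M is as close to 1 as desired, u tends to 1 everywhere.

    In the blocking case the limit profile is a true limit because u is
    nondecreasing in time ([front_like_nondecreasing]): this is
    [ancient_comparison] applied to u and its time translates, since the wave
    phi is strictly decreasing ([traveling_wave_decreasing]).

    All comparisons rest on one minimum principle on the unbounded graph
    ([graph_minimum_principle]). *)

(** * Calculus on the real line *)

Lemma is_derive_continuous (R : realType) (f : R -> R) (x d : R) :
  is_derive x 1 f d -> {for x, continuous f}.
Proof.
by move=> [df _]; apply/differentiable_continuous/derivable1_diffP.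
Qed.

Lemma mean_value (R : realType) (f df : R -> R) (x y : R) : x < y ->
  (forall z, x <= z <= y -> is_derive z 1 f (df z)) ->
  exists2 z, x < z < y & f y - f x = df z * (y - x).
Proof.
move=> xy dfE; have [||z] := @MVT R f df x y xy.
- by move=> z; rewrite in_itv/= => /andP[xz zy]; apply: dfE; rewrite !ltW.
- apply: continuous_in_subspaceT => z; rewrite inE/= in_itv/= => /dfE.
  exact: is_derive_continuous.
by rewrite in_itv/= => xzy E; exists z.
Qed.

Lemma derive_ge0_nondecreasing (R : realType) (f df : R -> R) (x y : R) :
  x <= y -> (forall z, x <= z <= y -> is_derive z 1 f (df z)) ->
  (forall z, x < z < y -> 0 <= df z) -> f x <= f y.
Proof.
rewrite le_eqVlt => /predU1P[->//|xy] dfE df0.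
have [z /df0 dz E] := @mean_value R f df x y xy dfE.
by rewrite -subr_ge0 E mulr_ge0// subr_ge0 ltW.
Qed.

Lemma derive_gt0_increasing (R : realType) (f df : R -> R) (x y : R) :
  x < y -> (forall z, x <= z <= y -> is_derive z 1 f (df z)) ->
  (forall z, x < z < y -> 0 < df z) -> f x < f y.
Proof.
move=> xy dfE df0.
have [z /df0 dz E] := @mean_value R f df x y xy dfE.
by rewrite -subr_gt0 E mulr_gt0// subr_gt0.
Qed.

Lemma near_dist_lt (R : realType) (x e : R) : 0 < e ->
  \forall y \near x, `|y - x| < e.
Proof.
move=> e0; near=> y; rewrite distrC; near: y.
by apply/nbhs_ballP; exists e.
Unshelve. all: by end_near. Qed.

(** The integral from 0 vanishes on the negative axis, where there is nothing
    to integrate over, so a primitive on the whole line needs other base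
    points; the second clause ties it to the function F of the criterion. *)
Lemma antiderivative_exists (R : realType) (h : R -> R) : continuous h ->
  exists H : R -> R, (forall x : R, is_derive x 1 H (h x)) /\
    forall s, 0 <= s -> primitive h s = H s - H 0.
Proof.
move=> hc.
have hint (x y : R) :
    (@lebesgue_measure R).-integrable `[x, y] (EFin \o h).
  apply: continuous_compact_integrable; first exact: segment_compact.
  exact: continuous_subspaceT.
pose I (n x : R) := (\int[@lebesgue_measure R]_(t in `[- n, x]) h t)%R.
have dI (n x : R) : - n < x -> is_derive x 1 (I n) (h x).
  move=> nx; have xx1 : x < x + 1 by rewrite ltrDl.
  have [|D E] := @continuous_FTC1_closed R h (- n) x (x + 1) xx1 _ nx (hc x).
    exact: hint.
  by rewrite -E derive1E; exact: DeriveDef.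
pose A (n x : R) := I n x - I n 0.
have dA (n x : R) : - n < x -> is_derive x 1 (A n) (h x).
  move=> nx; have dIx := dI _ _ nx.
  rewrite -[h x]subr0; have := @is_derive_cst _ _ _ (I n 0) x 1.
  exact: is_deriveB.
(* A n is independent of the base point - n, which can thus be taken to the
   left of any given x. *)
have AE (n m x : R) : 0 < n -> n <= m -> - n < x -> A n x = A m x.
  move=> n0 nm nx; apply/eqP; rewrite -subr_eq0; apply/eqP.
  change ((A n - A m) x = 0).
  have nmx (y : R) : - n < y -> - m < y by apply: le_lt_trans; rewrite lerN2.
  have d0 (z : R) : - n < z -> is_derive z 1 (A n - A m) ((fun=> 0) z).
    move=> nz; rewrite /= -(subrr (h z)).
    by apply: is_deriveB; apply: dA; [|exact: nmx].
  have A0 : (A n - A m) 0 = 0.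
    by rewrite /A; change (I n 0 - I n 0 - (I m 0 - I m 0) = 0); rewrite !subrr.
  have [x0|x0|->//] := ltgtP x 0.
    have [|z _] := @mean_value R (A n - A m) (fun=> 0) x 0 x0.
      by move=> z /andP[xz _]; apply: d0; apply: lt_le_trans xz.
    by rewrite A0 mul0r sub0r => /eqP; rewrite oppr_eq0 => /eqP.
  have [|z _] := @mean_value R (A n - A m) (fun=> 0) 0 x x0.
    by move=> z /andP[xz _]; apply: d0; apply: lt_le_trans xz; rewrite oppr_lt0.
  by rewrite A0 mul0r subr0.
pose H (x : R) := A (`|x| + 1) x.
have NL (x : R) : - (`|x| + 1) < x.
  by have := ler_norm (- x); rewrite normrN; lra.
exists H; split=> [x|s s0].
  apply: (@near_eq_is_derive _ _ _ (A (`|x| + 2)) H).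
    near=> y; have yx : `|y - x| < 1.
      by near: y; exact: near_dist_lt.
    apply: esym; apply: AE; last exact: NL.
      by have := normr_ge0 y; lra.
    by have := ler_distD x y 0; rewrite !subr0; lra.
  by apply: dA; have := NL x; lra.
have -> : H 0 = 0 by rewrite /H /A subrr.
rewrite subr0 /H (ger0_norm s0) /A /I /primitive.
rewrite Rintegral_itvB; first last.
- by rewrite bnd_simp.
- by rewrite bnd_simp; lra.
- exact: hint.
rewrite Rintegral_itv_obnd_cbnd//; apply: integrableS (hint 0 s) => //.
by apply: subset_itvr; rewrite bnd_simp.
Unshelve. all: by end_near. Qed.

Section pointwise_derivation_rules.
Variables (R : realType) (f g : R -> R) (x a b : R).
Hypotheses (df : is_derive x 1 f a) (dg : is_derive x 1 g b).

Lemma is_derive_add : is_derive x 1 (fun y => f y + g y) (a + b).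
Proof. exact: is_deriveD. Qed.

Lemma is_derive_sub : is_derive x 1 (fun y => f y - g y) (a - b).
Proof. exact: is_deriveB. Qed.

Lemma is_derive_mul : is_derive x 1 (fun y => f y * g y) (a * g x + f x * b).
Proof.
by apply: is_derive_eq (is_deriveM df dg) _; rewrite addrC (mulrC a).
Qed.

Lemma is_derive_cmul (k : R) : is_derive x 1 (fun y => k * f y) (k * a).
Proof. exact: is_deriveZ. Qed.

End pointwise_derivation_rules.

Lemma is_derive_const (R : realType) (k x : R) : is_derive x 1 (fun=> k) 0.
Proof. exact: is_derive_cst. Qed.

Lemma is_derive_affine (R : realType) (k l x : R) :
  is_derive x 1 (fun y => k * y + l) k.
Proof.
apply: is_derive_eq (is_derive_add (is_derive_cmul (is_derive_id x 1) k)
  (is_derive_const l x)) _.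
by rewrite mulr1 addr0.
Qed.

Section pointwise_within_continuity.
Variables (T : topologicalType) (R : realType) (K : set T) (f g : T -> R).
Hypotheses (fc : {within K, continuous f}) (gc : {within K, continuous g}).

Lemma within_continuous_add : {within K, continuous (fun x => f x + g x)}.
Proof. by move=> x; apply: cvgD; [exact: fc|exact: gc]. Qed.

Lemma within_continuous_sub : {within K, continuous (fun x => f x - g x)}.
Proof. by move=> x; apply: cvgB; [exact: fc|exact: gc]. Qed.

Lemma within_continuous_mul : {within K, continuous (fun x => f x * g x)}.
Proof. by move=> x; apply: cvgM; [exact: fc|exact: gc]. Qed.

End pointwise_within_continuity.
(** * Monotone profiles of v'' + h(v) = 0 *)

(** Global solution of p' = g(p) below a level M at which g vanishes at least
    linearly. Separation of variables inverts a primitive of 1/g; after the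
    substitution p = M - exp(-Y) the equation becomes Y' = k(Y) with
    0 < k <= C, so that the primitive of 1/k is onto and p never reaches M. *)
Lemma autonomous_flow (R : realType) (g : R -> R) (M C : R) : 0 < M ->
  continuous g -> (forall v, v < M -> 0 < g v <= C * (M - v)) ->
  exists p q : R -> R,
    [/\ (forall x, p x < M) /\ p 0 = 0, cancel p q,
        forall v, v < M -> p (q v) = v,
        forall x : R, is_derive x 1 p (g (p x)) &
        forall v : R, v < M -> is_derive v 1 q (g v)^-1].
Proof.
move=> M0 gc gP.
pose k s := g (M - expR (- s)) * expR s.
have ltM s : M - expR (- s) < M by rewrite ltrBlDr ltrDl expR_gt0.
have k0 s : 0 < k s by rewrite mulr_gt0 ?expR_gt0//; have /andP[] := gP _ (ltM s).
have kC s : k s <= C.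
  have /andP[_] := gP _ (ltM s).
  rewrite subKr -(ler_pM2r (expR_gt0 s)) => /le_trans; apply.
  by rewrite -mulrA -expRD addNr expR0 mulr1.
have C0 : 0 < C := lt_le_trans (k0 0) (kC 0).
have kc : continuous (fun s => (k s)^-1).
  move=> s; apply: continuousV; first by rewrite gt_eqF.
  apply: continuousM; last exact: continuous_expR.
  apply: (@continuous_comp _ _ _ (fun s => M - expR (- s)) g); last exact: gc.
  apply: continuousB; first exact: cst_continuous.
  apply: (@continuous_comp _ _ _ -%R expR); last exact: continuous_expR.
  exact: opp_continuous.
have [P [dP _]] := @antiderivative_exists R _ kc.
have cP : continuous P by move=> s; apply: is_derive_continuous (dP s).
(* As 1/k >= 1/C, P grows at least linearly and is onto. *)
have Pmono x y : x <= y -> C^-1 * (y - x) <= P y - P x.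
  rewrite le_eqVlt => /predU1P[->|xy]; first by rewrite !subrr mulr0.
  have [z _ ->] := @mean_value R P (fun s => (k s)^-1) x y xy (fun z _ => dP z).
  apply: ler_wpM2r; first by rewrite subr_ge0 ltW.
  by rewrite lef_pV2 ?posrE.
have Psurj t : exists s, P s = t.
  pose n := C * `|t - P 0|; have n0 : 0 <= n by rewrite mulr_ge0// ltW.
  have Cn : C^-1 * n = `|t - P 0| by rewrite mulKf ?gt_eqF.
  have hn := Pmono 0 n n0; have hNn := Pmono (- n) 0.
  rewrite oppr_le0 in hNn; have {}hNn := hNn n0.
  rewrite ?subr0 ?sub0r ?opprK Cn in hn hNn.
  have t1 := ler_norm (t - P 0); have := ler_norm (- (t - P 0)).
  rewrite normrN => t2.
  have [|||s _ <-] := @IVT R P (- n) n t; last by exists s.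
  - by lra.
  - exact: continuous_subspaceT.
  - by rewrite ge_min le_max; apply/andP; split; apply/orP; [left|right]; lra.
have [Y YK] := choice Psurj.
have Pinj x y : P x = P y -> x = y.
  move=> E; wlog xy : x y E / x <= y.
    by move=> W; have [/W|/ltW/W ->//] := leP x y; apply.
  have := Pmono _ _ xy; rewrite E subrr pmulr_rle0 ?invr_gt0// => yx.
  by apply/eqP; rewrite eq_le xy; move: yx; rewrite subr_le0.
have PK s : Y (P s) = s by apply: Pinj; rewrite YK.
have dY (t : R) : is_derive t 1 Y (k (Y t)).
  rewrite -{1}(YK t) -[k _]invrK; apply: is_derive_inverse.
  - by near=> s; exact: PK.
  - by near=> s; exact: cP.
  - by rewrite invr_eq0 gt_eqF.
pose c := P (- ln M).
exists (fun x => M - expR (- Y (x + c))), (fun v => P (- ln (M - v)) - c).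
split.
- by split=> [x|]; [exact: ltM|rewrite add0r PK opprK lnK ?posrE// subrr].
- by move=> x /=; rewrite subKr expRK opprK YK addrK.
- by move=> v vM; rewrite subrK PK opprK lnK ?posrE ?subr_gt0// subKr.
- move=> x.
  have dYc : is_derive x 1 (fun x => Y (x + c)) (k (Y (x + c))).
    have d1 : is_derive x 1 (fun x => x + c) (1 + 0) by exact: is_deriveD.
    rewrite -[k _]mulr1 -[X in _ * X]addr0.
    exact: (@is_derive1_comp _ Y (fun x => x + c)).
  have dE := @is_derive1_comp _ expR (fun x => - Y (x + c)) x _ _
     (is_derive_expR _) (is_deriveN dYc).
  apply: is_derive_eq (is_deriveB (is_derive_cst _ _ _) dE) _.
  by rewrite sub0r mulrN opprK /k mulrCA -expRD addNr expR0 mulr1.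
- move=> v vM; have Mv : 0 < M - v by rewrite subr_gt0.
  have d1 : is_derive v 1 (fun v => M - v) (0 - 1) by exact: is_deriveB.
  have dln := @is_derive1_comp _ (@ln R) (fun v => M - v) v _ _
     (is_derive1_ln Mv) d1.
  have dE := @is_derive1_comp _ P (fun v => - ln (M - v)) v _ _
     (dP _) (is_deriveN dln).
  apply: is_derive_eq (is_deriveB dE (is_derive_cst _ _ _)) _.
  rewrite subr0 sub0r mulrN1 opprK /k opprK lnK ?posrE// subKr.
  by rewrite expRN lnK ?posrE// -invfM divfK// gt_eqF.
Unshelve. all: by end_near. Qed.

(** The slope at level v of the solution of v'' + H'(v) = 0 that tends to M,
    read off the first integral v'^2/2 + H(v) = H(M). It is frozen below
    level 0, where profiles continue as straight lines: barriers matter only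
    where they are positive. *)
Definition energy_slope {R : realType} (H : R -> R) (M v : R) : R :=
  Num.sqrt (2 * (H M - H (Num.max v 0))).

(** Such a p rises from - oo to M and q is its inverse; the last field is the
    second-order equation p'' = - h(p). *)
Record rising_profile {R : realType} (h H : R -> R) (M : R) (p q : R -> R) :
  Prop := RisingProfile {
    profile_lt : forall x, p x < M ;
    profile0 : p 0 = 0 ;
    profileK : cancel p q ;
    profile_invK : forall v, v < M -> p (q v) = v ;
    profile_mono : {mono p : x y / x <= y} ;
    slope_gt0 : forall v, v < M -> 0 < energy_slope H M v ;
    derive_profile : forall x : R, is_derive x 1 p (energy_slope H M (p x)) ;
    derive_profile_inv : forall v : R, v < M ->
      is_derive v 1 q (energy_slope H M v)^-1 ;
    derive_slope_profile : forall x : R, 0 < p x ->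
      is_derive x 1 (energy_slope H M \o p) (- h (p x)) }.

(** The bound on h near M makes H(M) - H(v) quadratic there, hence the slope
    linear, as [autonomous_flow] requires. *)
Lemma rising_profile_exists (R : realType) (h H : R -> R) (M L : R) : 0 < M ->
  (forall s : R, is_derive s 1 H (h s)) ->
  (forall s, 0 <= s <= M -> `|h s| <= L * (M - s)) ->
  (forall v, 0 <= v < M -> H v < H M) ->
  exists p q, rising_profile h H M p q.
Proof.
move=> M0 dH hL HM.
have cH : continuous H by move=> s; apply: is_derive_continuous (dH s).
have max0M v : v < M -> 0 <= Num.max v 0 < M.
  by move=> vM; rewrite le_max lexx orbT gt_max vM.
have L0 : 0 <= L.
  have M0M : (0 : R) <= 0 <= M by rewrite lexx ltW.
  by have := le_trans (normr_ge0 _) (hL _ M0M); rewrite subr0 pmulr_lge0.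
have G0 v : v < M -> 0 < energy_slope H M v.
  by move=> /max0M/HM Hv; rewrite sqrtr_gt0 mulr_gt0// subr_gt0.
have GL v : v < M -> energy_slope H M v <= Num.sqrt (2 * L) * (M - v).
  move=> vM; set w := Num.max v 0; have /andP[w0 wM] := max0M _ vM.
  have vw : v <= w by rewrite le_max lexx.
  have [z /andP[wz zM] E] := @mean_value R H h w M wM (fun z _ => dH z).
  apply: (@le_trans _ _ (Num.sqrt (2 * L * (M - w) ^+ 2))); last first.
    rewrite sqrtrM ?mulr_ge0// sqrtr_sqr ger0_norm ?subr_ge0 ?(ltW wM)//.
    by rewrite ler_wpM2l ?sqrtr_ge0// lerB.
  rewrite ler_wsqrtr// -mulrA ler_wpM2l// E expr2 mulrA.
  rewrite ler_wpM2r ?subr_ge0 ?(ltW wM)//.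
  have zP : 0 <= z <= M by rewrite (le_trans w0 (ltW wz)) ltW.
  apply: le_trans (ler_norm _) (le_trans (hL _ zP) _).
  by rewrite ler_wpM2l// lerB// (ltW wz).
have cmax : continuous (fun v : R => Num.max v 0).
  by move=> v; apply: continuous_max; [exact: cvg_id|exact: cst_continuous].
have Gc : continuous (energy_slope H M).
  have -> : energy_slope H M =
    Num.sqrt \o (fun v => 2 * (H M - H (Num.max v 0))) by [].
  move=> v; apply: continuous_comp; last exact: sqrt_continuous.
  apply: continuousM; first exact: cst_continuous.
  apply: continuousB; first exact: cst_continuous.
  exact: (@continuous_comp R R R (fun v : R => Num.max v 0) H _ (cmax v) (cH _)).
have [|p [q [[pM p0] pK qK dp dq]]] := @autonomous_flow R _ M (Num.sqrt (2 * L)) M0 Gc.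
  by move=> v vM; rewrite G0// GL.
have plt x y : x < y -> p x < p y.
  move=> xy; apply: (@derive_gt0_increasing R p
    (fun x => energy_slope H M (p x))) => //.
  by move=> z _; apply: G0.
exists p, q; split => //.
  exact: le_mono plt.
move=> x px0; have Gx := G0 _ (pM x).
rewrite /energy_slope /=.
have pxE : Num.max (p x) 0 = p x by apply: max_l; exact: ltW.
have arg0 : 0 < 2 * (H M - H (p x)).
  by rewrite mulr_gt0// subr_gt0 HM// pM andbT ltW.
apply: (@near_eq_is_derive _ _ _ (fun y => Num.sqrt (2 * (H M - H (p y))))).
  near=> y; rewrite /= /energy_slope max_l//; apply: ltW; near: y.
  exact: (cvgr_gt (p x) (is_derive_continuous (dp x)) _ px0).
have dHp := @is_derive1_comp _ H p x _ _ (dH _) (dp x).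
have d1 := is_deriveZ 2 (is_deriveB (is_derive_cst (H M) x 1) dHp).
have dS := @is_derive1_comp _ Num.sqrt _ x _ _ (is_derive1_sqrt arg0) d1.
apply: (is_derive_eq dS); rewrite sub0r scalerN mulrN; congr (- _).
move: Gx; rewrite /energy_slope pxE => Gx.
set s := Num.sqrt _ in Gx *; rewrite /GRing.scale /=.
by field; rewrite gt_eqF.
Unshelve. all: by end_near. Qed.

Lemma profile_ge (R : realType) (h H : R -> R) (M : R) (p q : R -> R) (v x : R) :
  rising_profile h H M p q -> v < M -> q v <= x -> v <= p x.
Proof.
by move=> hp vM; rewrite -(profile_mono hp) (profile_invK hp).
Qed.

Lemma profile_gt0 (R : realType) (h H : R -> R) (M : R) (p q : R -> R) (x : R) :
  rising_profile h H M p q -> (0 < p x) = (0 < x).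
Proof.
move=> hp; rewrite -{1}(profile0 hp).
exact: (leW_mono (profile_mono hp)).
Qed.
(** * Comparison principle on the star graph *)

Lemma left_minimum_derive (R : realType) (f : R -> R) (a t d : R) : a < t ->
  is_derive t 1 f d -> (forall s, a <= s <= t -> f t <= f s) -> d <= 0.
Proof.
move=> at_ /is_derive1_caratheodory[g [gE gc <-]] fmin; rewrite leNgt.
apply/negP => gt0.
near t^'- => s.
have st : s < t by near: s; exact: nbhs_left_lt.
have as_ : a <= s by near: s; exact: nbhs_left_ge.
have gs : 0 < g s.
  near: s; apply: cvg_within; exact: (cvgr_gt (g t) gc _ gt0).
have /fmin : a <= s <= t by rewrite as_ ltW.
by rewrite -subr_ge0 gE pmulr_rge0// subr_ge0 leNgt st.
Unshelve. all: by end_near. Qed.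

Lemma interior_minimum_derive2 (R : realType) (f df : R -> R) (a b x d : R) :
  a < x < b -> (forall y : R, a < y -> is_derive y 1 f (df y)) ->
  is_derive x 1 df d -> (forall y, a <= y <= b -> f x <= f y) ->
  df x = 0 /\ 0 <= d.
Proof.
move=> /andP[ax xb] dfE d2 fmin.
have dfx0 : df x = 0.
  suff : is_derive x 1 f 0 by move=> [_ <-]; have [_ <-] := dfE _ ax.
  apply: (@derive1_at_min R f a b).
  - by rewrite ltW// (lt_trans ax).
  - by move=> y; rewrite in_itv/= => /andP[/dfE[]].
  - by rewrite in_itv/= ax.
  - by move=> y; rewrite in_itv/= => /andP[ay yb]; apply: fmin; rewrite !ltW.
split=> //; rewrite leNgt; apply/negP => dlt0.
have /is_derive1_caratheodory[g [gE gc gx]] := d2.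
rewrite -gx in dlt0.
have : \forall y \near x, g y < 0 by exact: (cvgr_lt (g x) gc _ dlt0).
move=> /nbhs_ballP[e /= e0 eg].
pose r := Num.min (e / 2) (b - x).
have r0 : 0 < r by rewrite lt_min divr_gt0// subr_gt0.
have re : r <= e / 2 by rewrite ge_min lexx.
have rb : r <= b - x by rewrite ge_min lexx orbT.
have [||z /andP[xz zr] E] := @mean_value R f df x (x + r).
- by rewrite ltrDl.
- by move=> z /andP[xz _]; apply/dfE/(lt_le_trans ax).
have : f x <= f (x + r) by apply: fmin; apply/andP; split; lra.
rewrite -subr_ge0 E addrAC subrr add0r pmulr_lge0//.
have -> : df z = g z * (z - x) by rewrite -gE dfx0 subr0.
rewrite pmulr_lge0 ?subr_gt0// leNgt; apply/negP; rewrite negbK.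
by apply: eg; rewrite /ball/= ltr_norml; apply/andP; split; lra.
Qed.

Lemma finite_min_exists (R : realType) (n : nat) (m : 'I_n -> R) (j0 : 'I_n) :
  exists j, forall k, m j <= m k.
Proof.
have [j _ jmin] := @Order.TotalTheory.arg_minP _ R _ j0 xpredT m isT.
by exists j => k; apply: jmin.
Qed.

(** The function exp(-(L + 3)(t - T)) z + e q(x), with q(x) = x^2 - 2x + 2
    and e > 0 small, is positive initially and for large x, so if z were
    negative somewhere it would reach a negative minimum. Inside a
    path the equation excludes this, and at the centre q'(0) < 0 makes the
    derivatives of z strictly positive on every path, against the Kirchhoff
    inequality. *)
Lemma graph_minimum_principle (R : realType) (N : nat) (rho : 'I_N -> R)
    (T T' L B : R) (z zx : 'I_N -> R -> R -> R) :
  (forall j, 0 < rho j) -> 0 <= L -> 0 <= B ->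
  (forall j, {within [set tx : R * R | 0 <= tx.2],
     continuous (fun tx : R * R => z j tx.1 tx.2)}) ->
  (forall j k t, z j t 0 = z k t 0) ->
  (forall j t x, T <= t <= T' -> 0 <= x -> - B <= z j t x) ->
  (forall j x, 0 <= x -> 0 <= z j T x) ->
  (forall j t (x : R), 0 < x -> is_derive x 1 (z j t) (zx j t x)) ->
  (forall j t, h^-1 * (z j t h - z j t 0) @[h --> 0^'+] --> zx j t 0) ->
  (forall j t (x : R), T < t <= T' -> 0 < x -> z j t x < 0 ->
     exists zt zxx, [/\ is_derive t 1 (fun s => z j s x) zt,
       is_derive x 1 (zx j t) zxx & zxx + L * z j t x <= zt]) ->
  (forall j t, T < t <= T' -> z j t 0 < 0 ->
     \sum_(k < N) rho k * zx k t 0 <= 0) ->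
  forall j t x, T <= t <= T' -> 0 <= x -> 0 <= z j t x.
Proof.
move=> rho0 L0 B0 zc zP zB zT zxE zx0 zpde zK j0 t0 x0 Tt0 x00.
rewrite leNgt; apply/negP => z0lt.
pose E t := expR ((L + 3) * (T - t)).
pose q (x : R) := x ^+ 2 - 2 * x + 2.
have E0 t : 0 < E t by exact: expR_gt0.
have q1 x : 1 <= q x.
  by have := sqr_ge0 (x - 1); rewrite /q sqrrB1; lra.
have q0 x : 0 < q x by apply: lt_le_trans (q1 x).
have ddq (x : R) : is_derive x 1 (fun x : R => 2 * x - 2) 2.
  exact: is_derive_affine.
have dq (x : R) : is_derive x 1 q (2 * x - 2).
  have d1 := is_derive_affine 1 (- 1) x.
  have d2 := is_derive_add (is_derive_mul d1 d1)
    (is_derive_const 1 x).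
  have -> : q = (fun y => (1 * y - 1) * (1 * y - 1) + 1).
    by apply/funext => y; rewrite /q; ring.
  by apply: is_derive_eq d2 _; ring.
have dE (t : R) : is_derive t 1 E (- (L + 3) * E t).
  have d1 := is_derive_affine (- (L + 3)) ((L + 3) * T) t.
  have d2 := @is_derive1_comp _ expR _ t _ _ (is_derive_expR _) d1.
  have -> : E = expR \o (fun y => - (L + 3) * y + (L + 3) * T).
    by apply/funext => y; rewrite /E /=; congr expR; ring.
  by apply: is_derive_eq d2 _; rewrite /= mulrC.
(* With this e the perturbed function is still negative at (t0, x0). *)
pose e := - (E t0 * z j0 t0 x0) / (2 * q x0).
have e0 : 0 < e.
  by rewrite divr_gt0 ?mulr_gt0// oppr_gt0 pmulr_rlt0.
pose Z j t x := E t * z j t x + e * q x.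
have Z0lt : Z j0 t0 x0 < 0.
  have -> : Z j0 t0 x0 = - (e * q x0).
    by rewrite /Z /e; field; rewrite gt_eqF.
  by rewrite oppr_lt0 mulr_gt0.
(* At distance X the quadratic term outweighs the lower bound - B. *)
pose X := x0 + 2 + B / e.
have Be0 : 0 <= B / e by rewrite divr_ge0// ltW.
have X0 : 0 < X by rewrite /X; lra.
have ZX j t : T <= t <= T' -> 0 < Z j t X.
  move=> tT; have zXB := zB j t X tT (ltW X0).
  have EzB : - B <= E t * z j t X.
    have [zn|zp] := leP 0 (z j t X).
      by apply: (@le_trans _ _ 0); [lra|rewrite mulr_ge0// ltW].
    apply: le_trans zXB _; rewrite -[leLHS]mul1r ler_wnM2r ?(ltW zp)//.
    rewrite /E -expR0 ler_expR mulr_ge0_le0//; first by rewrite addr_ge0.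
    by rewrite subr_le0; case/andP: tT.
  have qX : B < e * q X.
    rewrite -ltr_pdivrMl// mulrC.
    have := sqr_ge0 (X - 2); rewrite /q sqrrB /X => ?; nra.
  by rewrite /Z; lra.
pose K := [set` `[T, T']] `*` [set` `[0, X]] : set (R * R).
have Kt : K (t0, x0).
  by split; rewrite /= in_itv//= x00 /X; lra.
have cK : compact K by apply: compact_setX; exact: segment_compact.
have ZKc j : {within K, continuous (fun tx : R * R => Z j tx.1 tx.2)}.
  have KO : K `<=` [set tx : R * R | 0 <= tx.2].
    by move=> [t x] [_] /=; rewrite in_itv => /andP[].
  have Ec : continuous E by move=> t; apply: is_derive_continuous (dE t).
  have qc : continuous (fun x => e * q x).
    by move=> x; apply: is_derive_continuous (is_derive_cmul (dq x) e).
  have fstc : continuous (fun tx : R * R => E tx.1).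
    by move=> tx; apply: (continuous_comp cvg_fst (Ec _)).
  have sndc : continuous (fun tx : R * R => e * q tx.2).
    by move=> tx; apply: (continuous_comp cvg_snd (qc _)).
  have zK' := continuous_subspaceW KO (zc j).
  apply: within_continuous_add; last exact: (continuous_subspaceT sndc).
  by apply: within_continuous_mul; first exact: (continuous_subspaceT fstc).
have minj j : exists tx : R * R,
    K tx /\ forall sy, K sy -> Z j tx.1 tx.2 <= Z j sy.1 sy.2.
  have [tx] := compact_EVT_min (ex_intro _ _ Kt) cK (ZKc j).
  by rewrite inE => Ktx txmin; exists tx; split=> // sy Ksy; apply: txmin; rewrite inE.
have [m mP] := choice minj.
have [j jmin] := @finite_min_exists R N (fun j => Z j (m j).1 (m j).2) j0.
move: (mP j) => []; case mjE : (m j) => [t x] [/=].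
rewrite !in_itv/= => Tt /andP[x0' xX] _.
have Zmin k s y : T <= s <= T' -> 0 <= y <= X -> Z j t x <= Z k s y.
  move=> Ts yX; have := jmin k; rewrite mjE/= => /le_trans; apply.
  have [_ /(_ (s, y))] := mP k; apply.
  by split; rewrite /= in_itv.
have Zneg : Z j t x < 0.
  by apply: le_lt_trans Z0lt; apply: Zmin => //; rewrite x00 /X; lra.
have zneg : z j t x < 0.
  have : E t * z j t x < 0 by have := mulr_gt0 e0 (q0 x); move: Zneg; rewrite /Z; lra.
  by rewrite pmulr_rlt0.
have Tlt : T < t <= T'.
  move: Tt => /andP[Tt ->]; rewrite andbT lt_neqAle Tt andbT.
  by apply: contraTneq zneg => <-; rewrite -leNgt zT.
have xlt : x < X.
  rewrite lt_neqAle xX andbT; apply: contraTneq Zneg => ->.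
  by rewrite -leNgt ltW// ZX.
have [x_gt0|x_le0] := ltP 0 x; last first.
  have xE : x = 0 by apply/eqP; rewrite eq_le x_le0.
  subst x.
  have dge k : 2 * e <= E t * zx k t 0.
    rewrite leNgt; apply/negP => lt2.
    have cv : E t * (h^-1 * (z k t h - z k t 0)) + e * (h - 2) @[h --> 0^'+]
        --> E t * zx k t 0 + e * (0 - 2).
      apply: cvgD; apply: cvgM; first exact: cvg_cst.
      - exact: zx0.
      - exact: cvg_cst.
      by apply: cvgB; [exact: cvg_at_right_filter|exact: cvg_cst].
    have lt0 : E t * zx k t 0 + e * (0 - 2) < 0 by lra.
    near (0 : R)^'+ => h.
    have h0 : 0 < h by near: h; exact: nbhs_right_gt.
    have hX : h <= X by near: h; exact: nbhs_right_le.
    have : E t * (h^-1 * (z k t h - z k t 0)) + e * (h - 2) < 0.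
      by near: h; exact: (cvgr_lt _ cv).
    have hI : 0 <= h <= X by rewrite ltW.
    have := Zmin k t h Tt hI; rewrite (_ : Z j t 0 = Z k t 0); last first.
      by rewrite /Z (zP j k).
    rewrite -subr_ge0 (_ : _ - _ =
      h * (E t * (h^-1 * (z k t h - z k t 0)) + e * (h - 2))).
      by rewrite pmulr_rge0// leNgt => /negbTE ->.
    by rewrite /Z /q; field; rewrite gt_eqF.
  have := zK j t Tlt zneg; rewrite leNgt => /negP; apply.
  rewrite -(pmulr_rgt0 _ (E0 t)) mulr_sumr (bigD1 j)//=.
  rewrite ltr_pwDl//.
    rewrite mulrCA mulr_gt0//; apply: lt_le_trans (dge j).
    by rewrite mulr_gt0.
  apply: sumr_ge0 => k _; rewrite mulrCA mulr_ge0 ?(ltW (rho0 k))//.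
  by apply: le_trans (dge k); rewrite mulr_ge0// ltW.
have [zt [zxx [dzt dzxx pde]]] := zpde j t x Tlt x_gt0 zneg.
have dt : E t * (zt - (L + 3) * z j t x) <= 0.
  apply: (@left_minimum_derive R (fun s => Z j s x) T t).
  - by case/andP: Tlt.
  - have d1 := is_derive_mul (dE t) dzt.
    apply: is_derive_eq (is_derive_add d1 (is_derive_const (e * q x) t)) _.
    by ring.
  - move=> s /andP[Ts st]; apply: Zmin; last by rewrite x0' ltW.
    by rewrite Ts (le_trans st)//; case/andP: Tlt.
have dZ (y : R) : 0 < y ->
    is_derive y 1 (Z j t) (E t * zx j t y + e * (2 * y - 2)).
  move=> y0; exact: is_derive_add (is_derive_cmul (zxE j t y y0) (E t))
    (is_derive_cmul (dq y) e).
have ddZ := is_derive_add (is_derive_cmul dzxx (E t))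
  (is_derive_cmul (ddq x) e).
have x0X : 0 < x < X by rewrite x_gt0.
have [_] := interior_minimum_derive2 x0X dZ ddZ
  (fun y => Zmin j t y Tt).
move: (q1 x) (E0 t) e0 Zneg dt pde; rewrite /Z.
move: (E t) (q x) (z j t x) => Et qx zj qx1 Et0 e_gt0 Zn dt pde dxx.
have zn : Et * zj <= - e by nra.
have : Et * (zxx + L * zj) <= Et * zt by rewrite ler_pM2l.
lra.
Unshelve. all: by end_near. Qed.

Lemma is_derive_right_limit (R : realType) (f : R -> R) (d : R) :
  is_derive (0 : R) 1 f d -> h^-1 * (f h - f 0) @[h --> 0^'+] --> d.
Proof.
move=> /is_derive1_caratheodory[g [gE gc <-]].
apply: (@cvg_trans _ (g h @[h --> 0^'+])); last exact: cvg_at_right_filter.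
apply: near_eq_cvg; near=> h.
rewrite gE subr0 mulrC mulfK//; near: h; exact: nbhs_right_neq.
Unshelve. all: by end_near. Qed.

(** The regularity of a solution in space; wx is the derivative, one-sided at
    the centre. *)
Record graph_C1 {R : realType} {N : nat} (w wx : 'I_N -> R -> R -> R) : Prop :=
  GraphC1 {
    graph_continuous : forall j, {within [set tx : R * R | 0 <= tx.2],
      continuous (fun tx : R * R => w j tx.1 tx.2)} ;
    graph_junction : forall j k t, w j t 0 = w k t 0 ;
    graph_derive : forall j t (x : R), 0 < x ->
      is_derive x 1 (w j t) (wx j t x) ;
    graph_derive0 : forall j t,
      h^-1 * (w j t h - w j t 0) @[h --> 0^'+] --> wx j t 0 }.

(** Explicit barriers extend across the centre on each path, so their one-sided
    derivative there is the ordinary one. *)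
Lemma smooth_graph_C1 (R : realType) (N : nat) (w wx : 'I_N -> R -> R -> R) :
  (forall j, continuous (fun tx : R * R => w j tx.1 tx.2)) ->
  (forall j k t, w j t 0 = w k t 0) ->
  (forall j t (x : R), is_derive x 1 (w j t) (wx j t x)) -> graph_C1 w wx.
Proof.
move=> wc wP dw; split=> //.
- by move=> j; apply: continuous_subspaceT.
- by move=> j t; apply: is_derive_right_limit.
Qed.

(** The shift e is what allows comparison on time intervals starting at
    ever earlier times, where the ordering holds up to a small error only. *)
Lemma graph_comparison (R : realType) (N : nat) (rho : 'I_N -> R)
    (T T' L B e : R) (v vx w wx : 'I_N -> R -> R -> R) :
  (forall j, 0 < rho j) -> 0 <= L -> 0 <= B ->
  graph_C1 v vx -> graph_C1 w wx ->
  (forall j t x, 0 <= x -> v j t x <= w j t x + e + B) ->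
  (forall j x, 0 <= x -> v j T x <= w j T x + e) ->
  (forall j t (x : R), T < t <= T' -> 0 < x -> w j t x + e < v j t x ->
     exists vt vxx wt wxx,
       [/\ is_derive t 1 (fun s => v j s x) vt /\ is_derive x 1 (vx j t) vxx,
           is_derive t 1 (fun s => w j s x) wt /\ is_derive x 1 (wx j t) wxx &
           (vt - vxx) - (wt - wxx) <= L * (v j t x - w j t x - e)]) ->
  (forall j t, T < t <= T' -> w j t 0 + e < v j t 0 ->
     \sum_(k < N) rho k * wx k t 0 <= \sum_(k < N) rho k * vx k t 0) ->
  forall j t x, T <= t <= T' -> 0 <= x -> v j t x <= w j t x + e.
Proof.
move=> rho0 L0 B0 [vc vP dv dv0] [wc wP dw dw0] bd init pde K j t x tT x0.
rewrite -subr_ge0.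
pose z j t x := w j t x + e - v j t x; pose zx j t x := wx j t x - vx j t x.
have zlt0 k s y : (z k s y < 0) = (w k s y + e < v k s y) by rewrite subr_lt0.
apply: (@graph_minimum_principle R N rho T T' L B z zx) => //.
- move=> k; apply: within_continuous_sub; last exact: vc.
  apply: within_continuous_add; first exact: wc.
  by apply: continuous_subspaceT; exact: cst_continuous.
- by move=> k l s; rewrite /z (wP k l) (vP k l).
- by move=> k s y _ y0; have := bd k s y y0; rewrite /z; lra.
- by move=> k y y0; rewrite subr_ge0 init.
- move=> k s y y0; apply: is_derive_eq (is_derive_sub
    (is_derive_add (dw k s y y0) (is_derive_const e y)) (dv k s y y0)) _.
  by rewrite addr0.
- move=> k s; apply: cvg_trans (cvgB (dw0 k s) (dv0 k s)).
  by apply: near_eq_cvg; near=> h; rewrite /z fctE -mulrBr; congr (_ * _); ring.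
- move=> k s y sT y0; rewrite zlt0 => /(pde k s y sT y0).
  move=> [vt [vxx [wt [wxx [[dvt dvxx] [dwt dwxx] le]]]]].
  exists (wt - vt), (wxx - vxx); split.
  + apply: is_derive_eq (is_derive_sub
      (is_derive_add dwt (is_derive_const e s)) dvt) _.
    by rewrite addr0.
  + exact: is_derive_sub.
  + by move: le; rewrite /z; lra.
- move=> k s sT; rewrite zlt0 => /(K k s sT); rewrite -subr_le0 -sumrB.
  by under eq_bigr do rewrite -mulrBr.
Unshelve. all: by end_near. Qed.

Lemma solution_graph_C1 (R : realType) (N : nat) (rho : 'I_N -> R) (f : R -> R)
    (u : 'I_N -> R -> R -> R) : entire_solution rho f u ->
  exists ux, [/\ graph_C1 u ux,
    forall t, \sum_(j < N) rho j * ux j t 0 = 0 &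
    forall j (t x : R), 0 < x -> exists ut uxx : R,
      [/\ is_derive t 1 (fun s => u j s x) ut, is_derive x 1 (ux j t) uxx &
          ut = uxx + f (u j t x)]].
Proof.
move=> [uc [uP [ux [dux dux0 _ pde K]]]]; exists ux; split=> // j t x x0.
have [dt dx E] := pde j t x x0.
by do 2 eexists; split; [exact: derivableP dt|exact: derivableP dx|rewrite -!derive1E].
Qed.
(** * The nonlinearity and the traveling wave *)

Lemma bistable_is_derive (R : realType) (f : R -> R) (a : R) : bistable f a ->
  forall s : R, is_derive s 1 f (f^`() s).
Proof. by move=> [[df _] _ _ _ _] s; rewrite derive1E; apply/derivableP. Qed.

Lemma bistable_continuous (R : realType) (f : R -> R) (a : R) : bistable f a ->
  continuous f.
Proof.
by move=> hf s; apply: is_derive_continuous (@bistable_is_derive _ _ _ hf s).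
Qed.

Lemma bistable_lipschitz (R : realType) (f : R -> R) (a : R) : bistable f a ->
  exists2 L, 0 <= L & forall x y, 0 <= x <= 1 -> 0 <= y <= 1 ->
    `|f x - f y| <= L * `|x - y|.
Proof.
move=> hf; have dfE := bistable_is_derive hf.
have [[_ cdf] _ _ _ _] := hf.
have c01 : {within `[(0 : R), 1], continuous (fun s => `|f^`() s|)}.
  apply: continuous_subspaceT => s; apply: (@continuous_comp R R R); first exact: cdf.
  exact: norm_continuous.
have [m _ mP] := EVT_max ler01 c01.
exists `|f^`() m|; first exact: normr_ge0.
have lt x y : x < y -> 0 <= x <= 1 -> 0 <= y <= 1 ->
    `|f x - f y| <= `|f^`() m| * `|x - y|.
  move=> xy /andP[x0 _] /andP[_ y1].
  have [z /andP[xz zy] E] := mean_value xy (fun z _ => dfE z).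
  rewrite distrC E normrM (distrC x) ler_wpM2r// mP// in_itv/=.
  by rewrite (le_trans x0 (ltW xz)) (le_trans (ltW zy) y1).
move=> x y x01 y01; have [xy|yx|->] := ltgtP x y; first exact: lt.
  by rewrite distrC (distrC x) lt.
by rewrite !subrr normr0 mulr0.
Qed.

(** Used at the two stable states 0 and 1. *)
Lemma locally_decreasing (R : realType) (f : R -> R) (a s0 : R) :
  bistable f a -> f^`() s0 < 0 ->
  exists2 d, 0 < d & forall x y, s0 - d < x -> x < y -> y < s0 + d -> f y < f x.
Proof.
move=> hf f0; have dfE := bistable_is_derive hf.
have [[_ cdf] _ _ _ _] := hf.
have : \forall s \near s0, f^`() s < 0 by exact: (cvgr_lt _ (cdf s0) _ f0).
move=> /nbhs_ballP[d /= d0 dP]; exists d => // x y xd xy yd.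
have [z /andP[xz zy] E] := mean_value xy (fun z _ => dfE z).
rewrite -subr_lt0 E pmulr_llt0 ?subr_gt0//; apply: dP.
by rewrite /ball/= ltr_norml; apply/andP; split; lra.
Qed.

Lemma traveling_wave_limits (R : realType) (f phi : R -> R) (a c e : R) :
  traveling_wave f a phi c -> 0 < e ->
  exists2 Z, 0 < Z & (forall z, Z <= z -> phi z < e) /\
                     (forall z, z <= - Z -> 1 - e < phi z).
Proof.
move=> [_ _ _ _ [phiN phiP _]] e0.
have : \forall z \near +oo_R, phi z < e by exact: (cvgr_lt _ phiP).
move=> [A [_ AP]].
have : \forall z \near -oo_R, 1 - e < phi z.
  by apply: (cvgr_gt _ phiN); rewrite ltrBlDr ltrDl.
move=> [B [_ BP]].
exists (1 + `|A| + `|B|).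
  by have := normr_ge0 A; have := normr_ge0 B; lra.
have := ler_norm A; have := ler_norm (- B); rewrite normrN => B1 A1.
have A0 := normr_ge0 A; have B0 := normr_ge0 B.
by split=> z zZ; [apply: AP|apply: BP]; lra.
Qed.

Lemma antiderivative_neg (R : realType) (f F : R -> R) (a : R) :
  bistable f a -> (forall s : R, is_derive s 1 F (f s)) ->
  forall s, 0 < s <= a -> F s < F 0.
Proof.
move=> [_ _ _ [fneg _] _] dF s /andP[s0 sa].
have [z /andP[z0 zs] E] := mean_value s0 (fun z _ => dF z).
rewrite -subr_lt0 E pmulr_llt0 ?subr_gt0//; apply: fneg.
by rewrite z0 (lt_le_trans zs).
Qed.

(** The energy phi'^2/2 + F(phi) decreases and dominates F(phi), which tends
    to F(0); so F(phi) >= F(0) at a critical point; there phi > a, f(phi) > 0 and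
    phi'' < 0. Hence phi has no interior minimum on any interval, which for a
    function tending to 1 at - oo and staying below 1 leaves only strict
    decrease. *)
Lemma traveling_wave_decreasing (R : realType) (f phi : R -> R) (a c : R) :
  bistable f a -> traveling_wave f a phi c ->
  forall x y, x < y -> phi y < phi x.
Proof.
move=> hf hphi.
have [c0 dphi phiE phi01 [phiN phiP _]] := hphi.
have d1 (z : R) : is_derive z 1 phi (phi^`() z).
  by rewrite derive1E; apply/derivableP; case: (dphi z).
have d2 (z : R) : is_derive z 1 phi^`() (phi^`()^`() z).
  by rewrite [_^`()^`() z]derive1E; apply/derivableP; case: (dphi z).
have [F [dF _]] := antiderivative_exists (bistable_continuous hf).
pose E z := phi^`() z * phi^`() z / 2 + F (phi z).
have dE (z : R) : is_derive z 1 E (- c * phi^`() z ^+ 2).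
  have h1 := is_derive_cmul (is_derive_mul (d2 z) (d2 z)) 2^-1.
  have h2 := @is_derive1_comp _ F phi z _ _ (dF _) (d1 z).
  have -> : E = (fun y => 2^-1 * (phi^`() y * phi^`() y) + (F \o phi) y).
    by apply/funext => y; rewrite /E mulrC.
  apply: is_derive_eq (is_derive_add h1 h2) _.
  have -> : f (phi z) = - phi^`()^`() z - c * phi^`() z by have := phiE z; lra.
  by field.
have Edecr x y : x <= y -> E y <= E x.
  move=> xy; rewrite -lerN2.
  have dNE (z : R) : is_derive z 1 (- E) (c * phi^`() z ^+ 2).
    by rewrite -[c * _]opprK -mulNr; exact: is_deriveN.
  apply: (derive_ge0_nondecreasing xy (fun z _ => dNE z)).
  by move=> z _; rewrite mulr_ge0 ?sqr_ge0// ltW.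
have E0 z : F 0 <= E z.
  rewrite leNgt; apply/negP => Ez.
  have cF : continuous F by move=> s; apply: is_derive_continuous (dF s).
  have cvF : F (phi y) @[y --> +oo_R] --> F 0 by exact: (cvg_comp _ _ phiP (cF 0)).
  near +oo_R => y.
  have Ezy : E z < F (phi y) by near: y; exact: (cvgr_gt _ cvF).
  have zy : z <= y by near: y; exact: nbhs_pinfty_ge (num_real z).
  have Ey : F (phi y) <= E y by rewrite /E lerDr -expr2 divr_ge0 ?sqr_ge0.
  by have := Edecr _ _ zy; lra.
have nomin x m y : x < m < y -> ~ (forall z, x <= z <= y -> phi m <= phi z).
  move=> xmy mmin.
  have [dm0 ddm0] := interior_minimum_derive2 xmy (fun z _ => d1 z) (d2 m) mmin.
  have [p0 p1] := andP (phi01 m).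
  have : F 0 <= F (phi m) by have := E0 m; rewrite /E dm0 mul0r mul0r add0r.
  have [pa|ap _] := leP (phi m) a.
    rewrite leNgt => /negP; apply.
    by apply: (antiderivative_neg hf dF); rewrite p0.
  have [_ _ _ [_ fpos] _] := hf.
  have : 0 < f (phi m) by apply: fpos; rewrite ap.
  by have := phiE m; rewrite dm0; lra.
move=> x y xy; rewrite ltNge; apply/negP => xley.
have [z zx yz] : exists2 z, z < x & phi y < phi z.
  near -oo_R => z; exists z; first by near: z; exact: nbhs_ninfty_lt (num_real x).
  by near: z; apply: (cvgr_gt _ phiN); case/andP: (phi01 y).
have zy := lt_trans zx xy.
have [m] := EVT_min (ltW zy) (continuous_subspaceT
  (fun z => is_derive_continuous (d1 z))).
rewrite in_itv/= => /andP[zm my] mP.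
have mmin s : z <= s <= y -> phi m <= phi s by move=> ?; apply: mP; rewrite in_itv.
have mx : phi m <= phi x by apply: mmin; rewrite !ltW.
have zm' : z < m.
  rewrite lt_neqAle zm andbT; apply/eqP => zm'; move: mx; rewrite -zm'; lra.
have [my'|ym] := ltP m y; first by apply: (nomin z m y) mmin; rewrite zm'.
apply: (nomin z x y); first by rewrite zx.
move=> s szy; have -> : phi x = phi m; last exact: mmin.
have -> : m = y by apply/eqP; rewrite eq_le my.
apply/eqP; rewrite eq_le xley; move: mx; have -> // : m = y.
by apply/eqP; rewrite eq_le my.
Unshelve. all: by end_near. Qed.
(** * Front-like solutions *)

Lemma time_shift_continuous (R : realType) (w : R -> R -> R) (h : R) :
  {within [set tx : R * R | 0 <= tx.2], continuous (fun tx : R * R => w tx.1 tx.2)} ->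
  {within [set tx : R * R | 0 <= tx.2],
    continuous (fun tx : R * R => w (tx.1 + h) tx.2)}.
Proof.
move=> /subspace_continuousP wc; apply/subspace_continuousP => -[t x] /= x0.
pose sh (tx : R * R) := (tx.1 + h, tx.2).
have shc : sh @ nbhs (t, x) --> nbhs (sh (t, x)).
  have c1 : (fun tx : R * R => tx.1 + h) @ nbhs (t, x) --> nbhs (t + h).
    by apply: cvgD; [exact: cvg_fst|exact: cvg_cst].
  have c2 : (fun tx : R * R => tx.2) @ nbhs (t, x) --> nbhs x by exact: cvg_snd.
  exact: cvg_pair c1 c2.
apply: (@cvg_comp _ _ _ sh (fun tx => w tx.1 tx.2)
  _ (within [set tx : R * R | 0 <= tx.2] (nbhs (sh (t, x))))); last exact: wc.
move=> A wA; have := shc _ wA; rewrite /within /=.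
exact: id.
Qed.

(** The suprema in the definition range over bounded sets since 0 < u < 1 and
    0 < phi < 1, so they dominate each value. *)
Lemma front_estimate (R : realType) (N : nat) (rho : 'I_N -> R) (f phi : R -> R)
    (a c : R) (i : 'I_N) (u : 'I_N -> R -> R -> R) (e : R) :
  traveling_wave f a phi c -> front_like_solution rho f phi c i u -> 0 < e ->
  exists T, forall t, t <= T ->
    (forall x, 0 <= x -> `|u i t x - phi (- x - c * t)| < e) /\
    (forall j x, j != i -> 0 < x -> u j t x < e).
Proof.
move=> [_ _ _ phi01 _] [_ u01 ulim] e0.
have [T [_ TP]] := cvgr_lt _ ulim _ e0.
exists (T - 1) => t tT; have {}tT : t < T by lra.
have := TP t tT; set S1 := [set _ | _ in _]; set S2 := [set _ | _ in _] => lte.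
have S1ub : has_ubound S1.
  exists 1 => _ [x /= x0 <-]; have /andP[? ?] := u01 i t x x0.
  by have /andP[? ?] := phi01 (- x - c * t); rewrite ler_norml; apply/andP; split; lra.
have S2ub : has_ubound S2.
  exists 1 => _ [[j x] /= [_ x0] <-]; have /andP[? ?] := u01 j t x (ltW x0).
  by rewrite ger0_norm; lra.
have S1ge x : 0 <= x -> `|u i t x - phi (- x - c * t)| <= sup S1.
  by move=> x0; apply: ub_le_sup => //; exists x.
have S2ge j x : j != i -> 0 < x -> `|u j t x| <= sup S2.
  by move=> ji x0; apply: ub_le_sup => //; exists (j, x).
have S1pos : 0 <= sup S1 by apply: le_trans (S1ge 0 _).
have S2pos : 0 <= sup S2.
  have [->|/set0P[y Sy]] := eqVneq S2 set0; first by rewrite sup0.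
  apply: (@le_trans _ _ y); last exact: ub_le_sup.
  by case: Sy => p _ <-; exact: normr_ge0.
split=> [x x0|j x ji x0].
  by apply: le_lt_trans (S1ge x x0) _; lra.
by apply: le_lt_trans (ler_norm _) _; apply: le_lt_trans (S2ge j x ji x0) _; lra.
Qed.

(** Before T1 the order f(u) <= f(w) where u exceeds w makes w + e a
    supersolution against u for every constant e, so the ordering at times
    tending to - oo, known up to e, persists until T1; letting e tend to 0 gives
    u <= w, and after T1 the Lipschitz bound suffices. *)
Lemma ancient_comparison (R : realType) (N : nat) (rho : 'I_N -> R)
    (f : R -> R) (a : R) (u w wx : 'I_N -> R -> R -> R) (T1 : R) :
  (forall j, 0 < rho j) -> bistable f a -> entire_solution rho f u ->
  (forall j t (x : R), 0 <= x -> 0 < u j t x < 1) ->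
  graph_C1 w wx -> (forall j t (x : R), 0 <= x -> 0 < w j t x < 1) ->
  (forall t, \sum_(j < N) rho j * wx j t 0 <= 0) ->
  (forall j (t x : R), 0 < x -> exists wt wxx : R,
     [/\ is_derive t 1 (fun s => w j s x) wt, is_derive x 1 (wx j t) wxx &
         wxx + f (w j t x) <= wt]) ->
  (forall e t, 0 < e -> exists2 T, T <= t &
     forall j x, 0 <= x -> u j T x <= w j T x + e) ->
  (forall j t x, t <= T1 -> 0 < x -> w j t x < u j t x ->
     f (u j t x) <= f (w j t x)) ->
  forall j t x, 0 <= x -> u j t x <= w j t x.
Proof.
move=> rho0 hf hu u01 wC1 w01 wK wpde wT wf.
have [ux [uC1 uK updeE]] := solution_graph_C1 hu.
have K e T T' j t : T < t <= T' -> w j t 0 + e < u j t 0 ->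
    \sum_(k < N) rho k * wx k t 0 <= \sum_(k < N) rho k * ux k t 0.
  by rewrite uK.
have bd e j t x : 0 <= e -> 0 <= x -> u j t x <= w j t x + e + 1.
  move=> e0 x0; have /andP[_ ?] := u01 j t x x0.
  by have /andP[? _] := w01 j t x x0; lra.
have pde j (t x : R) : 0 < x -> exists vt vxx wt wxx : R,
   [/\ is_derive t 1 (fun s => u j s x) vt /\ is_derive x 1 (ux j t) vxx,
       is_derive t 1 (fun s => w j s x) wt /\ is_derive x 1 (wx j t) wxx &
       (vt - vxx) - (wt - wxx) <= f (u j t x) - f (w j t x)].
  move=> x0; have [vt [vxx [dvt dvxx vE]]] := updeE j t x x0.
  have [wt [wxx [dwt dwxx wE]]] := wpde j t x x0.
  by exists vt, vxx, wt, wxx; split=> //; lra.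
have early j t x : t <= T1 -> 0 <= x -> u j t x <= w j t x.
  move=> tT1 x0; apply/ler_addgt0Pr => e e0.
  have [T Tt uT] := wT e t e0.
  have tT : T <= t <= T1 by rewrite Tt.
  apply: (@graph_comparison _ _ rho T T1 0 1 e u ux w wx) (tT) x0 => //.
  - by move=> k s y y0; apply: bd => //; exact: ltW.
  - move=> k s y /andP[_ sT1] y0 lt.
    have [vt [vxx [wt [wxx [h1 h2 h3]]]]] := pde k s y y0.
    exists vt, vxx, wt, wxx; split=> //; rewrite mul0r.
    have : f (u k s y) <= f (w k s y) by apply: wf => //; lra.
    by lra.
  - exact: K.
move=> j t x x0; have [tT1|tT1] := leP t T1; first exact: early.
have [L L0 fL] := bistable_lipschitz hf.
have tT : T1 <= t <= t by rewrite lexx ltW.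
rewrite -[leRHS]addr0.
apply: (@graph_comparison _ _ rho T1 t L 1 0 u ux w wx) (tT) x0 => //.
- by move=> k s y y0; apply: bd.
- by move=> k y y0; rewrite addr0; apply: early.
- move=> k s y _ y0; rewrite addr0 => lt.
  have [vt [vxx [wt [wxx [h1 h2 h3]]]]] := pde k s y y0.
  exists vt, vxx, wt, wxx; split=> //; apply: le_trans h3 _.
  have /andP[u0 u1] := u01 k s y (ltW y0).
  have /andP[w0 w1] := w01 k s y (ltW y0).
  apply: le_trans (ler_norm _) _; apply: le_trans (fL _ _ _ _) _.
  + by rewrite !ltW.
  + by rewrite !ltW.
  + by rewrite subr0 gtr0_norm ?subr_gt0.
- exact: K.
Qed.

(** Early on, u and its translate by h are close to phi(z) and phi(z - ch) on
    the incoming path, and u is near 0 elsewhere. Where u exceeds the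
    translate, z avoids the transition zone of the wave, as the gap between
    phi(z - ch) and phi(z) is bounded below there; so both functions are near 0
    or near 1, where f decreases. *)
Lemma front_like_nondecreasing (R : realType) (N : nat) (rho : 'I_N -> R)
    (f phi : R -> R) (a c : R) (i : 'I_N) (u : 'I_N -> R -> R -> R) :
  (forall j, 0 < rho j) -> bistable f a -> traveling_wave f a phi c ->
  front_like_solution rho f phi c i u ->
  forall j x, 0 <= x -> {homo (fun t => u j t x) : s t / s <= t}.
Proof.
move=> rho0 hf hphi hu j x x0 s t; rewrite le_eqVlt => /predU1P[->//|st].
have [hs u01 _] := hu; have [c0 _ _ phi01 _] := hphi.
have [_ _ _ _ [f0 _ f1 _]] := hf.
have phid := traveling_wave_decreasing hf hphi.
have [h h0 {st t}->] : exists2 h, 0 < h & t = s + h.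
  by exists (t - s); rewrite ?subr_gt0// addrC subrK.
have [ux [[uc uP du du0] uK updeE]] := solution_graph_C1 hs.
have [d0 d0_gt0 d0P] := locally_decreasing hf f0.
have [d1 d1_gt0 d1P] := locally_decreasing hf f1.
pose d := Num.min d0 d1; have d_gt0 : 0 < d by rewrite lt_min d0_gt0.
have dd0 : d <= d0 by rewrite ge_min lexx.
have dd1 : d <= d1 by rewrite ge_min lexx orbT.
have d2 : 0 < d / 2 by rewrite divr_gt0.
have [Z Z0 [Zp Zn]] := traveling_wave_limits hphi d2.
have ch : 0 < c * h by rewrite mulr_gt0.
(* In the transition zone |z| <= Z the translate is ahead by at least k. *)
have [k k0 kP] : exists2 k, 0 < k &
    forall z, - Z <= z <= Z -> phi z + k <= phi (z - c * h).
  have dgap (z : R) : is_derive z 1 (fun z => phi (z - c * h) - phi z)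
      (phi^`() (z - c * h) - phi^`() z).
    have dphi (y : R) : is_derive y 1 phi (phi^`() y).
      by rewrite derive1E; apply/derivableP; case: hphi => _ /(_ y)[].
    apply: is_derive_sub (dphi z).
    have ds := is_derive_affine 1 (- (c * h)) z.
    have := @is_derive1_comp _ phi _ z _ _ (dphi _) ds.
    rewrite mulr1 mul1r => /(near_eq_is_derive _); apply.
    by near=> y; rewrite /= mul1r.
  have ZZ : - Z <= Z by lra.
  have [z0 _ z0P] := EVT_min ZZ (continuous_subspaceT
    (fun z => is_derive_continuous (dgap z))).
  exists (phi (z0 - c * h) - phi z0).
    by rewrite subr_gt0 phid// ltrBlDr ltrDl.
  by move=> z zZ; have := z0P z; rewrite in_itv/= => /(_ zZ); lra.
pose e := Num.min (k / 2) (d / 2).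
have e0 : 0 < e by rewrite lt_min !divr_gt0.
have ek : e <= k / 2 by rewrite ge_min lexx.
have ed : e <= d / 2 by rewrite ge_min lexx orbT.
have [T0 T0P] := front_estimate hphi hu e0.
apply: (@ancient_comparison _ _ rho f a u (fun j t x => u j (t + h) x)
  (fun j t x => ux j (t + h) x) (T0 - h)) x0 => //.
- split=> [l|l m r|l r y|l r]; [|exact: uP|exact: du|exact: du0].
  exact: time_shift_continuous.
- by move=> l r y y0; apply: u01.
- by move=> r; rewrite uK.
- move=> l r y y0; have [ut [uxx [dut duxx uE]]] := updeE l (r + h) y y0.
  exists ut, uxx; split=> //; last by rewrite uE.
  have ds := is_derive_affine 1 h r; rewrite -{1}[r]mul1r in dut.
  have := @is_derive1_comp _ (fun s => u l s y) _ r _ _ dut ds.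
  rewrite mulr1 => /(near_eq_is_derive _); apply.
  by near=> s'; rewrite /= mul1r.
- move=> e1 r e10; have e12 : 0 < e1 / 2 by rewrite divr_gt0.
  have [T TP] := front_estimate hphi hu e12.
  exists (Num.min r (T - h)) => [|l y y0]; first by rewrite ge_min lexx.
  set r' := Num.min _ _.
  have r'T : r' <= T - h by rewrite ge_min lexx orbT.
  have [|A1 A2] := TP r' _; first by lra.
  have [|B1 _] := TP (r' + h) _; first by lra.
  have ui y' : 0 <= y' -> u i r' y' <= u i (r' + h) y' + e1.
    move=> y'0; have := A1 y' y'0; have := B1 y' y'0; rewrite !ltr_norml.
    have := phid (- y' - c * (r' + h)) (- y' - c * r').
    rewrite mulrDr => /(_ _)/wrap[]; first by lra.
    by move=> ? /andP[? ?] /andP[? ?]; lra.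
  have [->|li] := eqVneq l i; first exact: ui.
  move: y0; rewrite le_eqVlt => /predU1P[<-|y0].
    by rewrite (uP l i) (uP l i (r' + h)) ui.
  have := A2 l y li y0; have /andP[? _] := u01 l (r' + h) y (ltW y0); lra.
move=> l r y rT y0 lt.
have [|A1 A2] := T0P r _; first by lra.
have [|B1 _] := T0P (r + h) _; first by lra.
have /andP[w0 w1] := u01 l (r + h) y (ltW y0).
have /andP[v0 v1] := u01 l r y (ltW y0).
have near0 : u l r y < d -> f (u l r y) <= f (u l (r + h) y).
  by move=> ud; apply/ltW/d0P => //; lra.
have [li|li] := eqVneq l i; last first.
  by apply: near0; have := A2 l y li y0; lra.
subst l; have := A1 y (ltW y0); have := B1 y (ltW y0); rewrite !ltr_norml.
rewrite mulrDr opprD addrA; move: (- y - c * r) => z.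
have := phid (z - c * h) z; rewrite ltrBlDr ltrDl ch => /(_ isT) phiz.
move=> /andP[B3 B4] /andP[A3 A4].
have [zZ|zZ] := leP Z z.
  by apply: near0; have := Zp z zZ; lra.
have [zZ'|zZ'] := leP z (- Z).
  by apply/ltW/d1P => //; have := Zn z zZ'; lra.
have := kP z; rewrite (ltW zZ) (ltW zZ') => /(_ isT) kz; exfalso; lra.
Unshelve. all: by end_near. Qed.

(** * Blocking *)

(** As the integral of f over [0, 1] is positive, the profile rising to 1
    with first integral F(1) has no turning point. *)
Lemma bistable_antiderivative_max (R : realType) (f F : R -> R) (a : R) :
  bistable f a -> (forall s : R, is_derive s 1 F (f s)) ->
  (forall s, 0 <= s -> primitive f s = F s - F 0) ->
  forall v, 0 <= v < 1 -> F v < F 1.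
Proof.
move=> hf dF FE v /andP[v0 v1].
have [_ /andP[a0 a1] _ [_ fpos] [_ _ _ F1]] := hf.
rewrite FE// subr_gt0 in F1.
have [va|av] := leP v a.
  apply: le_lt_trans F1; move: v0; rewrite le_eqVlt => /predU1P[<-//|v0].
  by apply/ltW/(antiderivative_neg hf dF); rewrite v0.
apply: (derive_gt0_increasing v1 (fun z _ => dF z)) => z /andP[vz z1].
by apply: fpos; rewrite z1 (lt_trans av).
Qed.

(** On the incoming path V is the profile of f started at level a; on the
    others a - V is the profile of s |-> - f(a - s), whose upper level a
    corresponds to V = 0. The criterion compares the two slopes at the
    centre. *)
Lemma steady_barrier_exists (R : realType) (N : nat) (rho : 'I_N -> R) (f : R -> R)
    (a : R) (i : 'I_N) : (forall j, 0 < rho j) -> bistable f a ->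
  primitive f 1 + (thickness_ratio rho i ^+ 2 - 1) * primitive f a <= 0 ->
  exists V Vx : 'I_N -> R -> R,
    [/\ graph_C1 (fun j _ => V j) (fun j _ => Vx j),
        \sum_(j < N) rho j * Vx j 0 <= 0 /\
        (forall j (x : R), 0 < x -> is_derive x 1 (Vx j) (- f (V j x))),
        (forall j x, 0 <= x -> 0 < V j x < 1) /\ (forall x, 0 <= x -> a <= V i x),
        (forall e, 0 < e -> exists X, forall x, X <= x -> 1 - e <= V i x) &
        forall j e, j != i -> 0 < e -> exists X, forall x, X <= x -> V j x <= e].
Proof.
move=> rho0 hf cond.
have fc := bistable_continuous hf.
have [F [dF FE]] := antiderivative_exists fc.
have [_ /andP[a0 a1] [f0 fa f1] [fneg fpos] _] := hf.
have [L L0 fL] := bistable_lipschitz hf.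
have [||p [q hp]] := @rising_profile_exists _ f F 1 L ltr01 dF.
- move=> s /andP[s0 s1]; rewrite -[f s]subr0 -f1.
  apply: le_trans (fL _ _ _ _) _; rewrite ?s0 ?lexx ?ler01//.
  by rewrite distrC ger0_norm// subr_ge0.
- exact: bistable_antiderivative_max hf dF FE.
pose h s := - f (a - s); pose H s := F (a - s).
have dH (s : R) : is_derive s 1 H (h s).
  have ds := is_derive_affine (- 1) a s.
  have -> : H = F \o (fun s => -1 * s + a).
    by apply/funext => y; rewrite /H /= mulN1r addrC.
  apply: is_derive_eq (@is_derive1_comp _ F _ s _ _ (dF _) ds) _.
  by rewrite mulrN1 /h mulN1r (addrC _ a).
have [||r [t hr]] := @rising_profile_exists _ h H a L a0 dH.
- move=> s /andP[s0 sa]; rewrite /h normrN -[f _]subr0 -f0.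
  have as0 : 0 <= a - s by rewrite subr_ge0.
  apply: le_trans (fL _ _ _ _) _; rewrite ?lexx ?ler01//.
    by rewrite as0; lra.
  by rewrite subr0 ger0_norm.
- move=> v /andP[v0 va]; rewrite /H subrr.
  by apply: (antiderivative_neg hf dF); apply/andP; split; lra.
have Fa : F a < F 0.
  by apply: (antiderivative_neg hf dF); rewrite a0 lexx.
have rat0 : 0 <= thickness_ratio rho i.
  by rewrite divr_ge0 ?sumr_ge0// => *; exact: ltW.
have sumE : \sum_(k < N | k != i) rho k = rho i * thickness_ratio rho i.
  by rewrite mulrC divfK// gt_eqF.
pose V j x := if j == i then p (x + q a) else a - r x.
pose Vx j x := if j == i then energy_slope F 1 (p (x + q a))
               else - energy_slope H a (r x).
have Vi x : V i x = p (x + q a) by rewrite /V eqxx.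
have Vj j x : j != i -> V j x = a - r x by rewrite /V => /negbTE ->.
have qa : p (q a) = a by apply: (profile_invK hp).
have dshift (x : R) : is_derive x 1 (fun x => x + q a) 1.
  have := is_derive_affine 1 (q a) x.
  by under [X in is_derive _ _ X]eq_fun do rewrite mul1r.
have dV j (x : R) : is_derive x 1 (V j) (Vx j x).
  rewrite /V /Vx; case: eqP => [_|_].
    apply: is_derive_eq (@is_derive1_comp _ p _ x _ _
      (derive_profile hp _) (dshift x)) _.
    by rewrite mulr1.
  apply: is_derive_eq (is_derive_sub (is_derive_const a x)
    (derive_profile hr x)) _.
  by rewrite sub0r.
have Via x : 0 <= x -> a <= V i x.
  by move=> x0; rewrite Vi -{1}qa (profile_mono hp) lerDr.
have r0 x : 0 <= x -> 0 <= r x.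
  by move=> x0; rewrite -(profile0 hr) (profile_mono hr).
exists V, Vx; split.
- apply: (smooth_graph_C1 _ _ (fun j _ x => dV j x)) => [j tx|j k _].
    exact: (continuous_comp cvg_snd (is_derive_continuous (dV j tx.2))).
  have V0 l : V l 0 = a.
    have [->|li] := eqVneq l i; first by rewrite Vi add0r.
    by rewrite Vj// (profile0 hr) subr0.
  by rewrite !V0.
- split=> [|j x x0].
    rewrite (bigD1 i)//= [in X in _ + X](eq_bigr
      (fun k => rho k * - energy_slope H a 0)).
      rewrite -mulr_suml sumE mulrN subr_le0 -mulrA ler_pM2l//.
      rewrite /Vx eqxx add0r qa /energy_slope !maxxx (max_l (ltW a0)).
      rewrite -[leRHS](ger0_norm (mulr_ge0 rat0 (sqrtr_ge0 _))).
      rewrite -sqrtr_sqr exprMn sqr_sqrtr; last first.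
        by rewrite mulr_ge0// /H subrr subr0 subr_ge0 ltW.
      rewrite ler_wsqrtr// /H subrr subr0.
      by move: cond; rewrite !FE ?ler01 ?(ltW a0)//; set th := thickness_ratio _ _; lra.
    by move=> k ki; rewrite /Vx (negbTE ki) (profile0 hr).
  rewrite /V /Vx; case: eqP => [_|_].
    apply: is_derive_eq (@is_derive1_comp _ (energy_slope F 1 \o p) _ x _ _
      (derive_slope_profile hp _) (dshift x)) _; last by rewrite mulr1.
    by apply: lt_le_trans a0 _; rewrite -Vi Via// ltW.
  have rx0 : 0 < r x by rewrite (profile_gt0 _ hr).
  have dr := derive_slope_profile hr rx0.
  apply: is_derive_eq (is_deriveN dr) _.
  by rewrite /h opprK.
- split=> // j x x0; have [->|ji] := eqVneq j i.
    by rewrite (lt_le_trans a0 (Via x x0)) Vi (profile_lt hp).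
  by rewrite Vj//; have := r0 x x0; have := profile_lt hr x; lra.
- move=> e e0; exists (q (1 - e) - q a) => x; rewrite lerBlDr Vi => /profile_ge.
  by apply; [exact: hp|rewrite ltrBlDr ltrDl].
- move=> j e ji e0; exists (t (a - e)) => x /profile_ge; rewrite Vj// => /(_ _ _ _ _ hr).
  by rewrite ltrBlDr ltrDl => /(_ e0); lra.
Qed.

(** The incoming path splits in two: near the centre u < a <= V as long as the
    front is far away, and further out V is so close to 1 that f decreases
    between V and 1. *)
Lemma blocking_upper_bound (R : realType) (N : nat) (rho : 'I_N -> R)
    (f phi : R -> R) (a c : R) (i : 'I_N) (u : 'I_N -> R -> R -> R)
    (V Vx : 'I_N -> R -> R) :
  (forall j, 0 < rho j) -> bistable f a -> traveling_wave f a phi c ->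
  front_like_solution rho f phi c i u ->
  graph_C1 (fun j _ => V j) (fun j _ => Vx j) ->
  \sum_(j < N) rho j * Vx j 0 <= 0 ->
  (forall j (x : R), 0 < x -> is_derive x 1 (Vx j) (- f (V j x))) ->
  (forall j x, 0 <= x -> 0 < V j x < 1) -> (forall x, 0 <= x -> a <= V i x) ->
  (forall e, 0 < e -> exists X, forall x, X <= x -> 1 - e <= V i x) ->
  forall j t x, 0 <= x -> u j t x <= V j x.
Proof.
move=> rho0 hf hphi hu VC1 VK dVx V01 Via Vi1 j t x x0.
have [hs u01 _] := hu; have [c0 _ _ phi01 _] := hphi.
have [_ /andP[a0 a1] _ _ [f0 _ f1 _]] := hf.
have [ux [[uc uP du du0] uK updeE]] := solution_graph_C1 hs.
have [d0 d0_gt0 d0P] := locally_decreasing hf f0.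
have [d1 d1_gt0 d1P] := locally_decreasing hf f1.
have a2 : 0 < a / 2 by rewrite divr_gt0.
have [Z Z0 [Zp Zn]] := traveling_wave_limits hphi a2.
have far X r y : c * r <= - (X + Z) -> y <= X -> phi (- y - c * r) < a / 2.
  by move=> cr yX; apply: Zp; lra.
have cdiv X r : r <= - (X + Z) / c -> c * r <= - (X + Z).
  by rewrite ler_pdivlMr// mulrC.
have small e r X : 0 < e -> e <= a ->
    (forall y, 0 <= y -> `|u i r y - phi (- y - c * r)| < e / 2) ->
    r <= - (X + Z) / c -> forall y, 0 <= y -> y <= X -> u i r y <= a.
  move=> e0 ea A1 rX y y0 yX; have := A1 y y0; rewrite ltr_norml => /andP[_].
  by have := far X r y (cdiv X r rX) yX; lra.
have d12 : 0 < d1 / 2 by rewrite divr_gt0.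
have [X1 X1P] := Vi1 _ d12.
pose e := Num.min (a / 2) d0.
have e0 : 0 < e by rewrite lt_min a2.
have ea : e <= a / 2 by rewrite ge_min lexx.
have ed : e <= d0 by rewrite ge_min lexx orbT.
have [T0 T0P] := front_estimate hphi hu e0.
apply: (@ancient_comparison _ _ rho f a u (fun j _ => V j) (fun j _ => Vx j)
  (Num.min T0 (- (X1 + Z) / c))) x0 => //.
- by move=> l _ y y0; apply: V01.
- move=> l r y y0; exists 0, (- f (V l y)); split.
  + exact: is_derive_const.
  + exact: dVx.
  + by rewrite addNr.
- move=> e1 r e10; pose e' := Num.min e1 a.
  have e'0 : 0 < e' by rewrite lt_min e10.
  have e'1 : e' <= e1 by rewrite ge_min lexx.
  have e'a : e' <= a by rewrite ge_min lexx orbT.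
  have e2 : 0 < e' / 2 by rewrite divr_gt0.
  have [T TP] := front_estimate hphi hu e2.
  have [X XP] := Vi1 _ e10.
  exists (Num.min r (Num.min T (- (X + Z) / c))) => [|l y y0].
    by rewrite ge_min lexx.
  set r' := Num.min _ _.
  have r'T : r' <= T by rewrite !ge_min lexx orbT.
  have r'X : r' <= - (X + Z) / c by rewrite !ge_min lexx !orbT.
  have [A1 A2] := TP r' r'T.
  have ui y' : 0 <= y' -> u i r' y' <= V i y' + e1.
    move=> y'0; have [Xy|yX] := leP X y'.
      by have := XP y' Xy; have /andP[_ ?] := u01 i r' y' y'0; lra.
    have := small e' r' X e'0 e'a A1 r'X y' y'0 (ltW yX).
    by have := Via y' y'0; lra.
  have [->|li] := eqVneq l i; first exact: ui.
  move: y0; rewrite le_eqVlt => /predU1P[<-|y0].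
    by rewrite (uP l i) (graph_junction VC1 l i 0) ui.
  by have := A2 l y li y0; have /andP[? _] := V01 l y (ltW y0); lra.
move=> l r y; rewrite le_min => /andP[rT rX] y0 lt.
have [A1 A2] := T0P r rT.
have /andP[w0 w1] := V01 l y (ltW y0).
have /andP[v0 v1] := u01 l r y (ltW y0).
have [li|li] := eqVneq l i; last first.
  by apply/ltW/d0P => //; have := A2 l y li y0; lra.
subst l; apply/ltW/d1P => //; last by lra.
have [Xy|yX] := leP X1 y; first by have := X1P y Xy; lra.
have := A1 y (ltW y0); rewrite ltr_norml => /andP[_].
have := far X1 r y (cdiv X1 r rX) (ltW yX).
by have := Via y (ltW y0); lra.
Qed.

Lemma front_like_cvg (R : realType) (N : nat) (rho : 'I_N -> R)
    (f phi : R -> R) (a c : R) (i : 'I_N) (u : 'I_N -> R -> R -> R) :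
  (forall j, 0 < rho j) -> bistable f a -> traveling_wave f a phi c ->
  front_like_solution rho f phi c i u ->
  forall j x, 0 <= x -> u j t x @[t --> +oo_R] --> limit_profile u j x.
Proof.
move=> rho0 hf hphi hu j x x0; have [_ u01 _] := hu.
have nd := front_like_nondecreasing rho0 hf hphi hu j x0.
apply: (cvgP (sup (range (fun t => u j t x)))).
apply: nondecreasing_cvgr => //.
by exists 1 => _ [t _ <-]; have /andP[_ /ltW] := u01 j t x x0.
Qed.
(** * Propagation *)

Lemma energy_slope_bounded (R : realType) (H : R -> R) (M : R) : 0 < M ->
  continuous H -> exists2 K, 0 < K & forall v, v < M -> energy_slope H M v <= K.
Proof.
move=> M0 cH; have [m _ mP] := EVT_min (ltW M0) (continuous_subspaceT cH).
exists (1 + Num.sqrt (2 * (H M - H m))) => [|v vM].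
  by rewrite ltr_wpDr ?sqrtr_ge0.
apply: (@le_trans _ _ (Num.sqrt (2 * (H M - H m)))); last by rewrite lerDr.
rewrite ler_wsqrtr// ler_wpM2l// lerB// mP// in_itv/= le_max lexx orbT/=.
by rewrite ge_max !ltW.
Qed.

Lemma antiderivatives_increment (R : realType) (G1 G2 g1 g2 : R -> R) (x y : R) :
  x < y -> (forall s : R, is_derive s 1 G1 (g1 s)) ->
  (forall s : R, is_derive s 1 G2 (g2 s)) ->
  (forall s, x <= s <= y -> g1 s = g2 s) -> G1 y - G1 x = G2 y - G2 x.
Proof.
move=> xy d1 d2 E.
have [z /andP[xz zy]] := mean_value xy
  (fun s _ => is_derive_sub (d1 s) (d2 s)).
by rewrite E ?(ltW xz) ?(ltW zy)// subrr mul0r; lra.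
Qed.

(** Take h1 = f - eta and h2 = min(h1, h1 / r), both vanishing at M because
    eta = f(M). Since r h2 <= h1, the first integrals give
    r (H2(M) - H2(v)) <= H1(M) - H1(v), which compares the slopes. When eta
    tends to 0 and M to 1, the integral of h2 over [0, M] tends to
    F(a) + (F(1) - F(a)) / r, positive by assumption; from a level near M it
    is positive because f > f(M) there. *)
Lemma invading_profiles_exist (R : realType) (f : R -> R) (a r e : R) :
  bistable f a -> 1 <= r -> 0 < primitive f 1 + (r - 1) * primitive f a ->
  0 < e -> exists eta M h1 H1 p1 q1 h2 H2 p2 q2,
    [/\ [/\ 0 < eta, 0 < M & 1 - e < M < 1],
        rising_profile h1 H1 M p1 q1 /\ (forall s, h1 s <= f s - eta),
        rising_profile h2 H2 M p2 q2 /\ (forall s, h2 s <= f s - eta),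
        exists2 K, 0 < K & forall v, v < M -> energy_slope H1 M v <= K &
        forall v, v < M ->
          Num.sqrt r * energy_slope H2 M v <= energy_slope H1 M v].
Proof.
move=> hf r1 cond e0.
have r0 : 0 < r by lra.
have rV1 : r^-1 <= 1 by rewrite invf_le1.
have rV0 : 0 < r^-1 by rewrite invr_gt0.
have fc := bistable_continuous hf.
have [F [dF FE]] := antiderivative_exists fc.
have [_ /andP[a0 a1] [f0 fa f1] [fneg fpos] [_ _ df1 _]] := hf.
have [L L0 fL] := bistable_lipschitz hf.
have [d d0 dP] := locally_decreasing hf df1.
pose cut (x : R) := Num.min x (x / r).
have cut_le x : cut x <= x by rewrite ge_min lexx.
have cut_le' x : cut x <= x / r by rewrite ge_min lexx orbT.
have cutN x : x <= 0 -> cut x = x by move=> x0; apply: min_l; nra.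
have cutP x : 0 <= x -> cut x = x / r by move=> x0; apply: min_r; nra.
have cut_norm x : `|cut x| <= `|x|.
  have [x0|x0] := leP 0 x; last by rewrite cutN ?(ltW x0).
  rewrite cutP// normrM ger0_norm// ger0_norm ?(ltW rV0)//; nra.
have cutB x eta : 0 <= eta -> cut x - eta <= cut (x - eta).
  move=> eta0; rewrite le_min; apply/andP; split.
    by rewrite lerB.
  rewrite mulrBl lerB//; nra.
have cutc (g : R -> R) : continuous g -> continuous (cut \o g).
  move=> gc; have -> : cut \o g = (g \min (fun x => r^-1 * g x)).
    by apply/funext => x; rewrite /= /cut mulrC.
  move=> x; apply: continuous_min; first exact: gc.
  by apply: continuousM; [exact: cst_continuous|exact: gc].
have [H0 [dH0 _]] := antiderivative_exists (cutc f fc).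
have H0a : H0 a - H0 0 = F a - F 0.
  apply: (antiderivatives_increment a0 dH0 dF) => s /andP[].
  rewrite le_eqVlt => /predU1P[<- _|s0]; first by rewrite /= f0 cutN.
  rewrite le_eqVlt => /predU1P[->|sa]; first by rewrite /= fa cutN.
  by rewrite /= cutN// ltW// fneg// s0.
have f_ge0 s : a <= s <= 1 -> 0 <= f s.
  move=> /andP[]; rewrite le_eqVlt => /predU1P[<- _|sa]; first by rewrite fa.
  rewrite le_eqVlt => /predU1P[->|s1]; first by rewrite f1.
  by rewrite ltW// fpos// sa.
have H01 : H0 1 - H0 a = r^-1 * (F 1 - F a).
  rewrite mulrBr.
  apply: (@antiderivatives_increment _ H0 (fun x => r^-1 * F x) _ _ _ _ a1 dH0
    (fun s => is_derive_cmul (dF s) r^-1)) => s sa1.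
  by rewrite /= cutP ?f_ge0// mulrC.
have H00 : H0 0 < H0 1.
  rewrite -subr_gt0.
  have -> : H0 1 - H0 0 = r^-1 * (F 1 - F 0 + (r - 1) * (F a - F 0)).
    have -> : H0 1 - H0 0 = r^-1 * (F 1 - F a) + (F a - F 0) by lra.
    by field; rewrite gt_eqF.
  by rewrite mulr_gt0// -!FE ?ler01// ltW.
(* m lies above a and in the zone near 1 where f decreases. *)
pose m := 1 - Num.min d (1 - a) / 2.
have md : Num.min d (1 - a) <= d by rewrite ge_min lexx.
have ma : Num.min d (1 - a) <= 1 - a by rewrite ge_min lexx orbT.
have m0 : 0 < Num.min d (1 - a) by rewrite lt_min d0 subr_gt0.
have m1 : m < 1 by rewrite /m; lra.
have am : a < m by rewrite /m; lra.
have dm : 1 - d < m by rewrite /m; lra.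
clearbody m; clear md ma m0.
have H0m : H0 m < H0 1.
  apply: (derive_gt0_increasing m1 (fun s _ => dH0 s)) => s /andP[ms s1].
  have fs : 0 < f s by apply: fpos; rewrite s1 (lt_trans am).
  by rewrite /= cutP ?(ltW fs)// divr_gt0.
(* g bounds from below the integrals of min(f, f / r) from levels in [0, m]
   up to 1; these integrals are smallest at 0 or at m. *)
pose g := Num.min (H0 1 - H0 m) (H0 1 - H0 0).
have g0 : 0 < g by rewrite lt_min !subr_gt0 H0m.
have g1 : g <= H0 1 - H0 m by rewrite ge_min lexx.
have g2 : g <= H0 1 - H0 0 by rewrite ge_min lexx orbT.
clearbody g.
have H0g v : 0 <= v <= m -> H0 v + g <= H0 1.
  move=> /andP[v0 vm]; have [va|av] := leP v a.
    suff : H0 v <= H0 0 by lra.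
    rewrite -lerN2 -(mulN1r (H0 0)) -(mulN1r (H0 v)).
    apply: (@derive_ge0_nondecreasing _ (fun x => -1 * H0 x) _ _ _ v0
      (fun s _ => is_derive_cmul (dH0 s) (-1))) => s /andP[s0 sv].
    rewrite mulN1r oppr_ge0; apply: le_trans (cut_le _) _.
    by rewrite ltW// fneg// s0 (lt_le_trans sv).
  suff : H0 v <= H0 m by lra.
  apply: (derive_ge0_nondecreasing vm (fun s _ => dH0 s)) => s.
  move=> /andP[vs sm]; have fs : 0 <= f s.
    by apply: f_ge0; rewrite !ltW// ?(lt_trans av) ?(lt_trans sm).
  by rewrite /= cutP// divr_ge0// ltW.
have [M [mM M1 eM [HM fM]]] : exists M, [/\ m < M, M < 1, 1 - e < M &
    H0 1 - g / 3 < H0 M /\ f M < g / 3].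
  have g3 : 0 < g / 3 by rewrite divr_gt0.
  have cH0 : H0 M @[M --> 1^'-] --> H0 1.
    by apply: cvg_at_left_filter; exact: is_derive_continuous (dH0 1).
  have cf1 : f M @[M --> 1^'-] --> 0.
    by rewrite -f1; apply: cvg_at_left_filter; exact: fc.
  near (1 : R)^'- => M; exists M; split; near: M.
  - exact: nbhs_left_gt.
  - exact: nbhs_left_lt.
  - by apply: nbhs_left_gt; lra.
  - near=> M; split; near: M.
      by apply: (cvgr_gt _ cH0); lra.
    exact: (cvgr_lt _ cf1).
have M0 : 0 < M by lra.
pose eta := f M; have eta0 : 0 < eta by apply: fpos; rewrite M1 (lt_trans am).
pose h1 s := f s - eta; pose H1 s := F s - eta * s.
have dH1 (s : R) : is_derive s 1 H1 (h1 s).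
  apply: is_derive_eq (is_derive_sub (dF s)
    (is_derive_cmul (is_derive_id s (1 : R)) eta)) _.
  by rewrite mulr1.
have h1c : continuous h1.
  by move=> s; apply: continuousB; [exact: fc|exact: cst_continuous].
pose h2 := cut \o h1.
have [H2 [dH2 _]] := antiderivative_exists (cutc h1 h1c).
have hL s : 0 <= s <= M -> `|h1 s| <= L * (M - s).
  move=> /andP[s0 sM]; apply: le_trans (fL _ _ _ _) _.
  - by rewrite s0 (le_trans sM)// ltW.
  - by rewrite !ltW.
  - by rewrite distrC ger0_norm// subr_ge0.
have H2M v : 0 <= v < M -> H2 v < H2 M.
  move=> /andP[v0 vM]; have [vm|mv] := leP v m.
    have : H2 v - H0 v + eta * v <= H2 M - H0 M + eta * M.
      apply: (@derive_ge0_nondecreasing _ (fun s => H2 s - H0 s + eta * s) _ _ _ (ltW vM)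
       (fun s _ => is_derive_add (is_derive_sub (dH2 s) (dH0 s))
        (is_derive_cmul (is_derive_id s (1 : R)) eta))) => s _.
      by have := cutB (f s) eta (ltW eta0); rewrite mulr1 /= /h1; lra.
    have : H0 v + g <= H0 1 by apply: H0g; rewrite v0.
    have : eta * (M - v) <= eta by nra.
    by move: fM; rewrite -/eta; lra.
  apply: (derive_gt0_increasing vM (fun s _ => dH2 s)) => s /andP[vs sM].
  have fs : 0 < h1 s by rewrite subr_gt0; apply: dP => //; lra.
  by rewrite /= cutP ?(ltW fs)// divr_gt0.
have H12 v : 0 <= v < M -> r * (H2 M - H2 v) <= H1 M - H1 v.
  move=> /andP[v0 vM].
  have : H1 v - r * H2 v <= H1 M - r * H2 M; last by lra.
  apply: (@derive_ge0_nondecreasing _ (fun s => H1 s - r * H2 s) _ _ _ (ltW vM)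
    (fun s _ => is_derive_sub (dH1 s) (is_derive_cmul (dH2 s) r))) => s _.
  by have := cut_le' (h1 s); rewrite ler_pdivlMr// mulrC subr_ge0.
have H1M v : 0 <= v < M -> H1 v < H1 M.
  move=> vM; rewrite -subr_gt0; apply: lt_le_trans (H12 v vM).
  by rewrite mulr_gt0// subr_gt0 H2M.
have [p1 [q1 hp1]] := @rising_profile_exists _ h1 H1 M L M0 dH1 hL H1M.
have [||p2 [q2 hp2]] := @rising_profile_exists _ h2 H2 M L M0 dH2.
- by move=> s sM; apply: le_trans (cut_norm _) (hL s sM).
- exact: H2M.
exists eta, M, h1, H1, p1, q1, h2, H2, p2, q2; split => //.
- by split => //; rewrite eM.
- by split => // s; exact: cut_le.
- by apply: energy_slope_bounded => // s; apply: is_derive_continuous (dH1 s).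
- move=> v vM; have vM' : 0 <= Num.max v 0 < M.
    by rewrite le_max lexx orbT gt_max vM.
  rewrite /energy_slope -sqrtrM ?(ltW r0)// ler_wsqrtr//.
  by have := H12 _ vM'; lra.
Unshelve. all: by end_near. Qed.

(** The barrier is p2(sg (t - s) - x) on the outgoing paths and
    p1(x + q1(b)) on the incoming one, with b = p2(sg (t - s)) their common
    value at the centre. Its time derivative is at most sg K = eta on both: on
    the incoming path this uses that the slope of p2 at level b does not
    exceed that of p1. *)
Lemma invasion_lower_bound (R : realType) (N : nat) (rho : 'I_N -> R)
    (f phi : R -> R) (a c : R) (i : 'I_N) (u : 'I_N -> R -> R -> R)
    (eta M K : R) (h1 H1 p1 q1 h2 H2 p2 q2 : R -> R) :
  (forall j, 0 < rho j) -> bistable f a -> traveling_wave f a phi c ->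
  front_like_solution rho f phi c i u ->
  0 < eta -> 0 < M < 1 -> 0 < K ->
  rising_profile h1 H1 M p1 q1 -> (forall s, h1 s <= f s - eta) ->
  rising_profile h2 H2 M p2 q2 -> (forall s, h2 s <= f s - eta) ->
  (forall v, v < M -> energy_slope H1 M v <= K) ->
  (forall v, v < M -> energy_slope H2 M v <= energy_slope H1 M v) ->
  (forall v, v < M ->
     thickness_ratio rho i * energy_slope H2 M v <= energy_slope H1 M v) ->
  forall j x v, 0 <= x -> v < M -> exists T, forall t, T <= t -> v <= u j t x.
Proof.
move=> rho0 hf hphi hu eta0 /andP[M0 M1] K0 hp1 h1f hp2 h2f sK s21 sR j x v x0 vM.
have [hs u01 _] := hu.
have [ux [uC1 uK updeE]] := solution_graph_C1 hs.
have [L L0 fL] := bistable_lipschitz hf.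
have e0 : 0 < (1 - M) / 2 by rewrite divr_gt0// subr_gt0.
have [T TP] := front_estimate hphi hu e0.
have [uT _] := TP T (lexx _); clear TP.
have [Z Z0 [_ Zn]] := traveling_wave_limits hphi e0.
pose X := `|Z - c * T|.
pose sg := eta / K; have sg0 : 0 < sg by rewrite divr_gt0.
(* Beyond X the solution exceeds M at time T; the time origin s is chosen so
   that at time T the incoming part of the barrier vanishes exactly at X. *)
pose s := T - q2 (p1 (- X)) / sg.
have p1M y : p1 y < M by exact: (profile_lt hp1).
have p2M y : p2 y < M by exact: (profile_lt hp2).
pose b t := p2 (sg * (t - s)).
pose W j t x := if j == i then p1 (x + q1 (b t)) else p2 (sg * (t - s) - x).
pose Wx j t x := if j == i then energy_slope H1 M (p1 (x + q1 (b t)))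
                 else - energy_slope H2 M (p2 (sg * (t - s) - x)).
have bM t : b t < M by exact: p2M.
have W0 k t : W k t 0 = b t.
  by rewrite /W; case: eqP => _; rewrite ?add0r ?subr0// (profile_invK hp1).
have WM k t y : W k t y < M by rewrite /W; case: eqP.
have daff (t : R) : is_derive t 1 (fun t => sg * (t - s)) sg.
  have := is_derive_affine sg (- (sg * s)) t.
  by under [X in is_derive _ _ X]eq_fun do rewrite -mulrBr.
have dsh (k y : R) : is_derive y 1 (fun y => y + k) 1.
  have := is_derive_affine 1 k y.
  by under [X in is_derive _ _ X]eq_fun do rewrite mul1r.
have drf (k y : R) : is_derive y 1 (fun y => k - y) (-1).
  have := is_derive_affine (-1) k y.
  by under [X in is_derive _ _ X]eq_fun do rewrite mulN1r addrC.
have db (t : R) : is_derive t 1 b (energy_slope H2 M (b t) * sg).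
  exact: (@is_derive1_comp _ p2 _ t _ _ (derive_profile hp2 _) (daff t)).
have dqb (t : R) : is_derive t 1 (q1 \o b)
    ((energy_slope H1 M (b t))^-1 * (energy_slope H2 M (b t) * sg)).
  exact: (@is_derive1_comp _ q1 _ t _ _ (derive_profile_inv hp1 (bM t)) (db t)).
have dWx k t (y : R) : is_derive y 1 (W k t) (Wx k t y).
  rewrite /W /Wx; case: eqP => [_|_].
    apply: is_derive_eq (@is_derive1_comp _ p1 _ y _ _
      (derive_profile hp1 _) (dsh (q1 (b t)) y)) _.
    by rewrite mulr1.
  apply: is_derive_eq (@is_derive1_comp _ p2 _ y _ _
    (derive_profile hp2 _) (drf (sg * (t - s)) y)) _.
  by rewrite mulrN1.
have WC1 : graph_C1 W Wx.
  apply: (smooth_graph_C1 _ _ dWx) => [k|k l t]; last by rewrite !W0.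
  have p1c : continuous p1.
    by move=> y; apply: is_derive_continuous (derive_profile hp1 y).
  have p2c : continuous p2.
    by move=> y; apply: is_derive_continuous (derive_profile hp2 y).
  have qbc : continuous (q1 \o b) by move=> t; apply: is_derive_continuous (dqb t).
  have ac : continuous (fun t => sg * (t - s)).
    by move=> t; apply: is_derive_continuous (daff t).
  have qbc1 : continuous (fun tx : R * R => q1 (b tx.1)).
    by move=> tx; apply: (continuous_comp cvg_fst (qbc _)).
  have ac1 : continuous (fun tx : R * R => sg * (tx.1 - s)).
    by move=> tx; apply: (continuous_comp cvg_fst (ac _)).
  rewrite /W; case: (k == i) => tx.
    apply: (@continuous_comp _ _ _ (fun tx : R * R => tx.2 + q1 (b tx.1)) p1);
      last exact: p1c.
    apply: cvgD; first exact: cvg_snd.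
    exact: qbc1.
  apply: (@continuous_comp _ _ _ (fun tx : R * R => sg * (tx.1 - s) - tx.2) p2);
    last exact: p2c.
  apply: cvgB; last exact: cvg_snd.
  exact: ac1.
have Wpde k (t y : R) : 0 < W k t y -> exists wt wxx : R,
    [/\ is_derive t 1 (fun r => W k r y) wt, is_derive y 1 (Wx k t) wxx &
        wt - wxx <= f (W k t y)].
  have sgK : sg * K = eta by rewrite /sg divfK// gt_eqF.
  rewrite /W /Wx; case: eqP => _ W0'.
    exists (energy_slope H1 M (p1 (y + q1 (b t))) *
      ((energy_slope H1 M (b t))^-1 * (energy_slope H2 M (b t) * sg))),
      (- h1 (p1 (y + q1 (b t)))); split.
    - have dsum := is_derive_add (is_derive_const y t) (dqb t).
      apply: is_derive_eq (@is_derive1_comp _ p1 _ t _ _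
        (derive_profile hp1 _) dsum) _.
      by rewrite add0r.
    - apply: is_derive_eq (@is_derive1_comp _ (energy_slope H1 M \o p1) _ y _ _
        (derive_slope_profile hp1 W0') (dsh _ y)) _.
      by rewrite mulr1.
    - have := h1f (p1 (y + q1 (b t))); have := sK _ (p1M (y + q1 (b t))).
      have bS := slope_gt0 hp1 (bM t).
      have b2S := slope_gt0 hp2 (bM t).
      have Dsg : (energy_slope H1 M (b t))^-1 * (energy_slope H2 M (b t) * sg) <= sg.
        by rewrite mulrA ler_piMl// ?(ltW sg0)// ler_pdivrMl// mulr1 s21.
      have D0 : 0 <= (energy_slope H1 M (b t))^-1 * (energy_slope H2 M (b t) * sg).
        by rewrite ltW// mulr_gt0 ?invr_gt0// mulr_gt0.
      move: (p1 _) => w wK hw.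
      rewrite opprK -lerBrDr; apply: le_trans (ler_pM (sqrtr_ge0 _) D0 wK Dsg) _.
      by rewrite (mulrC K) sgK; lra.
  exists (energy_slope H2 M (p2 (sg * (t - s) - y)) * sg),
    (- h2 (p2 (sg * (t - s) - y))); split.
  - have dsum := is_derive_sub (daff t) (is_derive_const y t).
    apply: is_derive_eq (@is_derive1_comp _ p2 _ t _ _
      (derive_profile hp2 _) dsum) _.
    by rewrite subr0.
  - have dsl := derive_slope_profile hp2 W0'.
    apply: is_derive_eq (is_deriveN (@is_derive1_comp _ (energy_slope H2 M \o p2) _ y _ _
      dsl (drf _ y))) _.
    by rewrite mulrN1 opprK.
  - have := h2f (p2 (sg * (t - s) - y)).
    have WK := le_trans (s21 _ (p2M (sg * (t - s) - y))) (sK _ (p2M _)).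
    have : energy_slope H2 M (p2 (sg * (t - s) - y)) * sg <= K * sg.
      by rewrite ler_pM2r.
    by rewrite (mulrC K) sgK; lra.
have WT k y : 0 <= y -> W k T y <= u k T y.
  move=> y0; have /andP[uk0 uk1] := u01 k T y y0.
  have bT : b T = p1 (- X).
    rewrite /b /s opprB addrC subrK mulrC divfK ?gt_eqF//.
    exact: (profile_invK hp2).
  have p1le0 z : z <= 0 -> p1 z <= 0.
    by rewrite -{2}(profile0 hp1) (profile_mono hp1).
  have [ki|ki] := eqVneq k i; last first.
    apply: le_trans (ltW uk0); rewrite /W (negbTE ki).
    apply: (@le_trans _ _ (b T)).
      by rewrite /b (profile_mono hp2) gerDl oppr_le0.
    by rewrite bT p1le0// oppr_le0 normr_ge0.
  subst k; rewrite /W eqxx bT (profileK hp1).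
  have [yX|Xy] := leP y X.
    by apply: le_trans (ltW uk0); apply: p1le0; rewrite subr_le0.
  apply: (le_trans (ltW (p1M _))).
  have := uT y y0; rewrite ltr_norml => /andP[+ _].
  have := ler_norm (Z - c * T); rewrite -/X => ZX.
  by have := Zn (- y - c * T) _; lra.
have WK t : 0 <= \sum_(k < N) rho k * Wx k t 0.
  rewrite (bigD1 i)//= [X in _ + X](eq_bigr
    (fun k => rho k * - energy_slope H2 M (b t))).
    rewrite -mulr_suml mulrN subr_ge0.
    have -> : \sum_(k < N | k != i) rho k = rho i * thickness_ratio rho i.
      by rewrite mulrC divfK// gt_eqF.
    rewrite -mulrA ler_pM2l// /Wx eqxx add0r (profile_invK hp1)//.
    exact: sR.
  by move=> k ki; rewrite /Wx (negbTE ki) subr0.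
have uW t : T <= t -> W j t x <= u j t x.
  move=> Tt; rewrite -[leRHS]addr0.
  have tT : T <= t <= t by rewrite Tt lexx.
  apply: (@graph_comparison _ _ rho T t L 1 0 W Wx u ux) (tT) x0 => //.
  - move=> k r y y0; have := WM k r y; have /andP[] := u01 k r y y0; lra.
  - by move=> k y y0; rewrite addr0 WT.
  - move=> k r y _ y0; rewrite addr0 subr0 => uW.
    have /andP[uk0 uk1] := u01 k r y (ltW y0).
    have [wt [wxx [dwt dwxx wle]]] := Wpde k r y (lt_trans uk0 uW).
    have [ut [uxx [dut duxx uE]]] := updeE k r y y0.
    exists wt, wxx, ut, uxx; split=> //.
    have Wk1 := lt_trans (WM k r y) M1.
    have : `|f (W k r y) - f (u k r y)| <= L * `|W k r y - u k r y|.
      by apply: fL; rewrite !ltW// (lt_trans uk0).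
    rewrite (gtr0_norm (_ : 0 < W k r y - u k r y)) ?subr_gt0//.
    by have := ler_norm (f (W k r y) - f (u k r y)); lra.
  - by move=> k r _ _; rewrite uK.
exists (Num.max T (s + (x + q2 v) / sg)) => t; rewrite ge_max => /andP[Tt st].
apply: le_trans (uW t Tt).
have st' : x + q2 v <= sg * (t - s).
  by rewrite mulrC -ler_pdivrMr//; lra.
rewrite /W; case: eqP => _; last by apply: (profile_ge hp2) => //; lra.
apply: (@le_trans _ _ (b t)).
  by apply: (profile_ge hp2) => //; lra.
by apply: (profile_ge hp1) => //; rewrite lerDr.
Qed.

(** Using max(1, r^2) for the parameter of the profiles makes the slope of
    the outgoing profile smaller than the incoming one, both with and without
    the factor r. *)
Lemma propagation_cvg (R : realType) (N : nat) (rho : 'I_N -> R)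
    (f phi : R -> R) (a c : R) (i : 'I_N) (u : 'I_N -> R -> R -> R) :
  (forall j, 0 < rho j) -> bistable f a -> traveling_wave f a phi c ->
  front_like_solution rho f phi c i u ->
  0 < primitive f 1 + (thickness_ratio rho i ^+ 2 - 1) * primitive f a ->
  forall j x, 0 <= x -> u j t x @[t --> +oo_R] --> (1 : R).
Proof.
move=> rho0 hf hphi hu cond j x x0.
have [_ u01 _] := hu; have [_ _ _ _ [_ _ _ F1]] := hf.
set th := thickness_ratio rho i in cond *.
have th0 : 0 <= th by rewrite divr_ge0 ?sumr_ge0// => *; exact: ltW.
pose r := Num.max 1 (th ^+ 2).
have r1 : 1 <= r by rewrite le_max lexx.
have sr1 : 1 <= Num.sqrt r by rewrite -(@sqrtr1 R) ler_wsqrtr.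
have srth : th <= Num.sqrt r.
  by rewrite -(ger0_norm th0) -sqrtr_sqr ler_wsqrtr// le_max lexx orbT.
have condr : 0 < primitive f 1 + (r - 1) * primitive f a.
  have [h|h] := leP 1 (th ^+ 2); first by rewrite /r max_r.
  by rewrite /r max_l ?(ltW h)// subrr mul0r addr0.
apply/cvgrPdist_le => e e0.
have [eta [M [h1 [H1 [p1 [q1 [h2 [H2 [p2 [q2]]]]]]]]]] :=
  invading_profiles_exist hf r1 condr e0.
move=> [[eta0 M0 /andP[eM M1]] [hp1 h1f] [hp2 h2f] [K K0 sK] s12].
have s2 v k : k <= Num.sqrt r -> v < M ->
    k * energy_slope H2 M v <= energy_slope H1 M v.
  by move=> kr /s12; apply: le_trans; rewrite ler_wpM2r// sqrtr_ge0.
have M01 : 0 < M < 1 by rewrite M0.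
have s21 v : v < M -> energy_slope H2 M v <= energy_slope H1 M v.
  by move=> /(s2 _ _ sr1); rewrite mul1r.
have [T TP] := invasion_lower_bound
  rho0 hf hphi hu eta0 M01 K0 hp1 h1f hp2 h2f sK s21 (fun v => s2 v _ srth)
  j x0 eM.
near=> t.
have Tt : T <= t by near: t; exact: nbhs_pinfty_ge (num_real _).
have /andP[_ u1] := u01 j t x x0.
rewrite gtr0_norm ?subr_gt0//; have := TP t Tt; lra.
Unshelve. all: by end_near. Qed.

Unset Implicit Arguments.
Set Strict Implicit.

Theorem theorem2p13 (R : realType) (N : nat) (hN : (2 <= N)%N)
    (rho : 'I_N -> R) (hrho : forall i, 0 < rho i)
    (f : R -> R) (a : R) (hf : bistable f a)
    (phi : R -> R) (c : R) (hphi : traveling_wave f a phi c)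
    (i : 'I_N) (u : 'I_N -> R -> R -> R)
    (hu : front_like_solution rho f phi c i u) :
  (0 < primitive f 1 + (thickness_ratio rho i ^+ 2 - 1) * primitive f a ->
     (forall j, j != i -> propagation_index (limit_profile u) i j 1%N) /\
     (forall j (x : R), 0 <= x -> limit_profile u j x = 1)) /\
  (primitive f 1 + (thickness_ratio rho i ^+ 2 - 1) * primitive f a <= 0 ->
     forall j, j != i -> propagation_index (limit_profile u) i j 0%N).
Proof.
split=> [cond|cond j ji].
  have v1 j x : 0 <= x -> limit_profile u j x = 1.
    move=> x0; apply/cvg_lim => //.
    exact: (propagation_cvg hrho hf hphi hu cond).
  split=> // j ji; split; first by rewrite eq_sym.
  left; split=> //.
  apply: (@cvg_trans _ ((fun=> 1 : R) @ +oo_R)); last exact: cvg_cst.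
  by apply: near_eq_cvg; near=> x; rewrite v1.
split; first by rewrite eq_sym.
right; split=> //.
have [V [Vx [VC1 [VK dVx] [V01 Via] Vi1 Vj0]]] :=
  steady_barrier_exists hrho hf cond.
have uV := blocking_upper_bound
  hrho hf hphi hu VC1 VK dVx V01 Via Vi1.
have [_ u01 _] := hu.
apply/cvgrPdist_le => e e0; have [X XP] := Vj0 j e ji e0.
near=> x; have x0 : 0 <= x by near: x; exact: nbhs_pinfty_ge (num_real _).
have Xx : X <= x by near: x; exact: nbhs_pinfty_ge (num_real _).
have cu := front_like_cvg hrho hf hphi hu (j := j) x0.
have v0 : 0 <= limit_profile u j x.
  by apply: (cvgr_to_ge cu); near=> t; have /andP[/ltW] := u01 j t x x0.
have ve : limit_profile u j x <= e.
  apply: (cvgr_to_le cu); near=> t.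
  by apply: le_trans (uV j t x x0) (XP x Xx).
by rewrite sub0r normrN ger0_norm.
Unshelve. all: by end_near. Qed.
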